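(* Let $P_1,\dots,P_d, C_1,\dots,C_d$ be $n\times n$ positive semidefinite matrices and $\epsilon\in[(nd)^{-3},1/20]$, and run Algorithm 1 (described in the context). Define \[ f(x) := (1-\epsilon)\log\mathrm{Tr}\exp\left(\sum_{i=1}^dx_iP_i\right) + \log\mathrm{Tr}\exp\left(-\sum_{i=1}^dx_iC_i\right). \] Then on any iteration $t$ of Algorithm 1 (in which $x^{(t+1)}$ is produced), $f(x^{(t+1)})\le f(x^{(t)}) + (nd\rho)^{-15}$.
   Context: $\langle A,B\rangle = \mathrm{Tr}(AB)$; $\lambda_{\max},\lambda_{\min}$ are extreme eigenvalues; $\exp$ is the matrix exponential. Width: $\rho := \max_{i\in[d]}\lambda_{\max}(C_i)/\lambda_{\max}(P_i)$ (all $P_i\neq 0$). Algorithm 1: set $K = 4\log(nd\rho)/\epsilon$, $\alpha = 1/(8K)$, $x^{(0)}_i = 1/(d\lambda_{\max}(P_i))$, $t=0$. While $\lambda_{\max}(\sum_i x^{(t)}_iP_i)\le K$ and $\lambda_{\min}(\sum_i x^{(t)}_iC_i)\le K$: let $Y^{(t)} = \exp(\sum_i x^{(t)}_iP_i)$, $Z^{(t)} = \exp(-\sum_i x^{(t)}_iC_i)$, $\nabla_{P_i}^{(t)} = \langle P_i, Y^{(t)}/\mathrm{Tr}Y^{(t)}\rangle$, $\nabla_{C_i}^{(t)} = \langle C_i, Z^{(t)}/\mathrm{Tr}Z^{(t)}\rangle$, $W^{(t)} = \{i:\nabla_{P_i}^{(t)}\le(1-\epsilon/2)\nabla_{C_i}^{(t)}\}$;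 if $W^{(t)}=\emptyset$ return ''Infeasible''; set $\delta^{(t)}_i = \frac12(1-\nabla_{P_i}^{(t)}/\nabla_{C_i}^{(t)})$ for $i\in W^{(t)}$ and $0$ otherwise; $x^{(t+1)}_i = x^{(t)}_i(1+\alpha\delta^{(t)}_i)$; $t\gets t+1$. After the loop return ''Feasible'' and $x = x^{(t)}$. *)

(* Defs.v *)
From HB Require Import structures.
From mathcomp Require Import all_boot all_order all_algebra sesquilinear.
From mathcomp Require Import all_classical all_reals all_analysis.

Set Implicit Arguments.
Unset Strict Implicit.
Unset Printing Implicit Defensive.

Import Order.TTheory GRing.Theory Num.Theory.
Import numFieldNormedType.Exports.

Local Open Scope ring_scope.

Section Matrices.
Context {R : realType} {n : nat}.
Implicit Types A B : 'M[R]_n.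

Definition psdmx A : Prop :=
  A \is symmetricmx /\ forall v : 'rV[R]_n, 0 <= (v *m A *m v^T) 0 0.

(* The set of eigenvalues of a symmetric real matrix with n > 0 is finite and
   nonempty, so the sup and inf below are attained. *)
Definition lambda_max A : R := sup [set a | eigenvalue A a]%classic.
Definition lambda_min A : R := inf [set a | eigenvalue A a]%classic.

Definition expmx A : 'M[R]_n :=
  limn (series (fun k => (k`!%:R)^-1 *: A ^+ k)).

Definition mxdot A B : R := \tr (A *m B).

End Matrices.

Inductive alg_state (X : Type) :=
| Running of X
| Feasible of X
| Infeasible.
Arguments Infeasible {X}.

Section Algorithm.
Context {R : realType} {n d : nat}.
Variables (P C : 'I_d -> 'M[R]_n) (eps : R).
Implicit Types x : 'rV[R]_d.

(* The ratios are nonnegative for psd matrices, so starting the maximum at 0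
   does not change it when d > 0. *)
Definition width : R :=
  \big[Num.max/0]_(i < d) (lambda_max (C i) / lambda_max (P i)).

Definition ndrho : R := n%:R * d%:R * width.

(* If all C i vanish then ndrho = 0 and, since ln 0 = 0 here, bigK = 0; as with
   log 0 = -oo, the loop is then never entered. *)
Definition bigK : R := 4 * ln ndrho / eps.

Definition alpha : R := (8 * bigK)^-1.

Definition packing x : 'M[R]_n := \sum_(i < d) x 0 i *: P i.
Definition covering x : 'M[R]_n := \sum_(i < d) x 0 i *: C i.

Definition init : 'rV[R]_d := \row_i (d%:R * lambda_max (P i))^-1.

Definition guard x : bool :=
  (lambda_max (packing x) <= bigK) && (lambda_min (covering x) <= bigK).

Definition Ymx x : 'M[R]_n := expmx (packing x).
Definition Zmx x : 'M[R]_n := expmx (- covering x).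

Definition gradP x (i : 'I_d) : R := mxdot (P i) ((\tr (Ymx x))^-1 *: Ymx x).
Definition gradC x (i : 'I_d) : R := mxdot (C i) ((\tr (Zmx x))^-1 *: Zmx x).

Definition Wset x : {set 'I_d} :=
  [set i | gradP x i <= (1 - eps / 2) * gradC x i]%SET.

Definition delta x (i : 'I_d) : R :=
  if i \in Wset x then (1 - gradP x i / gradC x i) / 2 else 0.

Definition update x : 'rV[R]_d := \row_i (x 0 i * (1 + alpha * delta x i)).

Definition alg_step (s : alg_state 'rV[R]_d) : alg_state 'rV[R]_d :=
  if s is Running x then
    if guard x then
      if Wset x == finset.set0 then Infeasible else Running (update x)
    else Feasible x
  else s.

(* alg t = Running x means that x is the iterate x^(t) at the head of the
   loop, before its guard is tested. *)
Definition alg (t : nat) : alg_state 'rV[R]_d := iter t alg_step (Running init).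

Definition potential x : R :=
  (1 - eps) * ln (\tr (expmx (packing x)))
  + ln (\tr (expmx (- covering x))).

End Algorithm.

(* Main.v *)
Require Import Defs.
From mathcomp Require Import all_boot all_order all_algebra.
From mathcomp Require Import all_classical all_reals all_analysis.
From mathcomp Require complex.
From mathcomp Require Import ring lra.

(* Only the spectral theorem is needed, neither Golden-Thompson nor derivatives
   of the matrix exponential.  Put A_i = x_i P_i, Phi = sum_i A_i = V^T diag(y) V
   and Phi' = sum_i (1 + alpha delta_i) A_i = U^T diag(u) U.  With p = U V^T, the
   entries of D = Phi' - Phi between the two eigenbases are (u_i - y_j) p_ij, so
   that
     Tr f(Phi') - Tr f(Phi) - Tr D f'(Phi)
       = sum_ij p_ij^2 (f(u_i) - f(y_j) - (u_i - y_j) f'(y_j))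
   is a sum of D_ij^2 times second divided differences of f, and
   Tr M (f(Phi') - f(Phi)) is likewise a sum of M_ij D_ij times first divided
   differences.  Since the A_i are psd and sum to Phi, a Bessel inequality weighted
   by Phi^-1 bounds sum_i D_ij^2 / u_i by the j-th diagonal entry of
   alpha^2 sum_i delta_i^2 A_i in the eigenbasis V.  When Phi <= K this yields
     Tr exp Phi' <= Tr exp Phi + alpha sum_i (delta_i + 2/7 delta_i^2) Tr A_i exp Phi.
   For A_i = x_i C_i and f(r) = exp(-r), the sum Psi of the A_i may have
   eigenvalues far above K.  The divided differences of exp(-r) decay fast enough
   for the same estimate to hold (with -1 and 2/3 for 1 and 2/7) up to an error
   of order n exp(-3K/2), negligible against Tr exp(-Psi) >= exp(-K) if
   d rho > 2, for then n d rho >= 2n; if d rho <= 2, then Psi <= d rho K <= 2K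
   and there is no error.  The first-order gain grad P_i <= (1 - 2 delta_i) grad C_i
   absorbs both second-order terms. *)

Set Implicit Arguments.
Unset Strict Implicit.
Unset Printing Implicit Defensive.
Import Order.TTheory GRing.Theory Num.Theory.
Import numFieldNormedType.Exports.
Local Open Scope ring_scope.

(** * Spectral theorem for real symmetric matrices *)

Section SpectralTheorem.
Import complex.
Variable R : rcfType.

Lemma row_sqnorm_eq0 n (v : 'rV[R]_n) : ((v *m v^T) 0 0 == 0) = (v == 0).
Proof.
apply/eqP/eqP => [|->]; last by rewrite mul0mx mxE.
have E : (v *m v^T) 0 0 = \sum_i v 0 i ^+ 2.
  by rewrite mxE; apply: eq_bigr => i _; rewrite mxE.
rewrite E => /psumr_eq0P v0; apply/rowP => i; apply/eqP.
by rewrite mxE -sqrf_eq0; apply/eqP/v0 => // j _; exact: sqr_ge0.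
Qed.

Lemma row_sqnorm_ge0 n (v : 'rV[R]_n) : 0 <= (v *m v^T) 0 0.
Proof. by rewrite mxE sumr_ge0// => i _; rewrite mxE -expr2 sqr_ge0. Qed.

Lemma row_dotC n (u v : 'rV[R]_n) : u *m v^T = v *m u^T.
Proof.
apply/matrixP => i j; rewrite !ord1 !mxE.
by apply: eq_bigr => k _; rewrite !mxE mulrC.
Qed.

(** A complex eigenvector [p + i q] with eigenvalue [a] exists. By symmetry [p A q^T = q A p^T],
    which forces [Im a * (|p|^2 + |q|^2) = 0]; so [a] is real, and whichever of [p], [q] is nonzero
    is a real eigenvector. *)
Lemma symmetric_eigenvector n (A : 'M[R]_n.+1) : A^T = A ->
  exists (a : R) (v : 'rV[R]_n.+1), v != 0 /\ v *m A = a *: v.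
Proof.
move=> AT.
pose Ac : 'M[complex R]_n.+1 := map_mx (real_complex R) A.
have [a /eigenvalueP[v vA v0]] := @eigenvalue_closed _ _ Ac (ltn0Sn n).
pose p : 'rV[R]_n.+1 := map_mx (@Re R) v.
pose q : 'rV[R]_n.+1 := map_mx (@Im R) v.
have ReS (F : 'I_n.+1 -> complex R) : Re (\sum_i F i) = \sum_i Re (F i).
  by apply: big_morph => // -[? ?] [? ?].
have ImS (F : 'I_n.+1 -> complex R) : Im (\sum_i F i) = \sum_i Im (F i).
  by apply: big_morph => // -[? ?] [? ?].
have pA : p *m A = Re a *: p - Im a *: q.
  apply/rowP => j; have /rowP/(_ j)/(congr1 (@Re R)) := vA.
  rewrite !mxE ReS => ReA; transitivity (Re (a * v 0 j)).
    by rewrite -ReA; apply: eq_bigr => i _; rewrite !mxE; case: (v 0 i) => ? ? /=; ring.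
  by case: (a) (v 0 j) => ? ? [].
have qA : q *m A = Im a *: p + Re a *: q.
  apply/rowP => j; have /rowP/(_ j)/(congr1 (@Im R)) := vA.
  rewrite !mxE ImS => ImA; transitivity (Im (a * v 0 j)).
    by rewrite -ImA; apply: eq_bigr => i _; rewrite !mxE; case: (v 0 i) => ? ? /=; ring.
  by case: (a) (v 0 j) => ? ? [? ?] /=; ring.
have pq_neq0 : (p *m p^T) 0 0 + (q *m q^T) 0 0 != 0.
  rewrite paddr_eq0 ?row_sqnorm_ge0// !row_sqnorm_eq0.
  apply: contra v0 => /andP[/eqP p0 /eqP q0]; apply/eqP/rowP => i.
  move/rowP/(_ i) : p0; move/rowP/(_ i) : q0; rewrite !mxE.
  by case: (v 0 i) => ? ? /= -> ->.
have qp : (q *m p^T) 0 0 = (p *m q^T) 0 0.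
  by rewrite row_dotC.
have a0 : Im a = 0.
  have : (p *m A *m q^T) 0 0 = (q *m A *m p^T) 0 0.
    by rewrite row_dotC trmx_mul AT mulmxA.
  have lin (b c : R) (X Y : 'M[R]_1) : (b *: X + c *: Y) 0 0 = b * X 0 0 + c * Y 0 0.
    by rewrite !mxE.
  rewrite pA qA -scaleNr !mulmxDl -!scalemxAl !lin qp => E.
  have /eqP : Im a * ((p *m p^T) 0 0 + (q *m q^T) 0 0) = 0.
    lra.
  by rewrite mulf_eq0 (negbTE pq_neq0) orbF => /eqP.
have [p0|p0] := eqVneq p 0; last first.
  by exists (Re a), p; rewrite pA a0 scale0r subr0.
exists (Re a), q; rewrite qA a0 scale0r add0r; split=> //.
by apply: contra pq_neq0 => /eqP ->; rewrite p0 trmx0 mulmx0 !mxE addr0.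
Qed.

(* Householder reflection exchanging [u] and the first basis vector. *)
Lemma orthogonal_first_row n (u : 'rV[R]_(1 + n)) : u *m u^T = 1%:M ->
  exists Q : 'M[R]_(1 + n), [/\ Q^T = Q, Q *m Q = 1%:M & row 0 Q = u].
Proof.
move=> uu; pose e : 'rV[R]_(1 + n) := delta_mx 0 0; pose w := e - u.
have [/eqP w0|w0] := eqVneq w 0.
  exists 1%:M; rewrite trmx1 mulmx1 row1; split=> //.
  by apply/eqP; rewrite -subr_eq0.
have ee : e *m e^T = 1%:M.
  by rewrite trmx_delta mul_delta_mx; apply/matrixP => i j; rewrite !ord1 !mxE.
pose c := (w *m w^T) 0 0.
have c0 : c != 0 by rewrite row_sqnorm_eq0.
have wwT : w *m w^T = c%:M by rewrite [LHS]mx11_scalar.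
have ue : u *m e^T = e *m u^T by exact: row_dotC.
(* Since [e] and [u] are unit vectors, [|e - u|^2 = 2 (1 - <e, u>) = 2 <e, w>]. *)
have ew : e *m w^T = (c / 2)%:M.
  have -> : c = 2 * (e *m w^T) 0 0.
    rewrite /c /w linearB/= mulmxBl !mulmxBr ee uu ue !mxE/=; ring.
  by rewrite mulrC mulKf ?pnatr_eq0// [LHS]mx11_scalar.
exists (1%:M - (2 / c) *: (w^T *m w)); split.
- by rewrite linearB linearZ/= trmx1 trmx_mul trmxK.
- set X := (2 / c) *: _.
  have XX : X *m X = 2 *: X.
    rewrite /X -scalemxAl -scalemxAr mulmxA -(mulmxA w^T w) wwT mul_mx_scalar.
    by rewrite -scalemxAl !scalerA; congr (_ *: _); field.
  rewrite mulmxBl !mulmxBr !mul1mx !mulmx1 XX scaler_nat mulr2n.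
  by rewrite (opprD X X) (addrA X) subrr sub0r opprK subrK.
- rewrite rowE mulmxBr mulmx1 -scalemxAr mulmxA ew mul_scalar_mx scalerA.
  rewrite (_ : _ * _ = 1); first by rewrite scale1r /w opprB addrC subrK.
  by field.
Qed.

(** Deflation: conjugation by a reflection [Q] whose first row is a unit eigenvector makes [A] block
    diagonal with corner [l]; the induction hypothesis diagonalises the lower block. *)
Theorem symmetric_spectral n (A : 'M[R]_n) : A^T = A ->
  exists (U : 'M[R]_n) (a : 'rV[R]_n),
    U *m U^T = 1%:M /\ A = U^T *m diag_mx a *m U.
Proof.
elim: n A => [|n IHn] A AT.
  by exists 1%:M, 0; split; rewrite [LHS]flatmx0 [RHS]flatmx0.
have [l [v [v0 vA]]] := symmetric_eigenvector AT.
pose s := Num.sqrt ((v *m v^T) 0 0); pose u := s^-1 *: v.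
have s0 : 0 < s by rewrite sqrtr_gt0 lt_def row_sqnorm_eq0 v0 row_sqnorm_ge0.
have uu : u *m u^T = 1%:M.
  rewrite linearZ/= -scalemxAl -scalemxAr scalerA [v *m _]mx11_scalar.
  rewrite -[_ 0 0]sqr_sqrtr ?row_sqnorm_ge0// -/s scale_scalar_mx.
  by congr _%:M; field; exact: lt0r_neq0.
have uA : u *m A = l *: u by rewrite -scalemxAl vA !scalerA mulrC.
have [Q [QT QQ Q0]] := @orthogonal_first_row n u uu.
pose B : 'M[R]_(1 + n) := Q *m A *m Q.
have BT : B^T = B by rewrite /B !trmx_mul QT AT mulmxA.
have B0 : row 0 B = l *: delta_mx 0 0.
  by rewrite !row_mul Q0 uA -scalemxAl -Q0 -row_mul QQ row1.
have Bu : usubmx B = row_mx l%:M 0.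
  apply/matrixP => i j; rewrite !ord1.
  have /rowP/(_ j) := B0; rewrite !mxE => E.
  rewrite (_ : lshift n 0 = 0); last exact/val_inj.
  rewrite E; case: split_ordP => k ->; rewrite !mxE.
    by rewrite !ord1 eqxx/= mulr1.
  by rewrite (_ : rshift 1 k == 0 = false) ?andbF ?mulr0.
have BE : B = block_mx l%:M 0 0 (drsubmx B).
  rewrite -[LHS]submxK; congr block_mx.
  - by rewrite /ulsubmx Bu row_mxKl.
  - by rewrite /ursubmx Bu row_mxKr.
  - by rewrite -[LHS]trmxK trmx_dlsub BT /ursubmx Bu row_mxKr trmx0.
have /IHn[U [a [UU Ba]]] : (drsubmx B)^T = drsubmx B by rewrite trmx_drsub BT.
pose T : 'M[R]_(1 + n) := block_mx 1%:M 0 0 U.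
have TT : T *m T^T = 1%:M.
  rewrite tr_block_mx mulmx_block !trmx0 !trmx1.
  by rewrite !(mulmx0, mul0mx, mulmx1, addr0, add0r) UU -scalar_mx_block.
have TB : T^T *m diag_mx (row_mx l%:M a) *m T = B.
  rewrite diag_mx_row tr_block_mx !mulmx_block !trmx0 !trmx1.
  rewrite !(mulmx0, mul0mx, mulmx1, mul1mx, addr0, add0r) -Ba [RHS]BE.
  by congr block_mx; apply/matrixP => i j; rewrite !ord1 !mxE eqxx.
exists (T *m Q), (row_mx l%:M a); split.
  by rewrite trmx_mul QT -mulmxA (mulmxA Q) QQ mul1mx.
rewrite trmx_mul QT; transitivity (Q *m B *m Q); last by rewrite -TB !mulmxA.
by rewrite /B !mulmxA QQ mul1mx -mulmxA QQ mulmx1.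
Qed.

End SpectralTheorem.

(** * Functional calculus in an orthonormal eigenbasis *)

Section FunctionalCalculus.
Variables (R : realType) (n : nat).
Implicit Types (U V M : 'M[R]_n) (a b : 'rV[R]_n) (f g h : R -> R).

(** The rows of [U] serve as an orthonormal eigenbasis with eigenvalues [a], so this is [f] applied
    to the symmetric matrix [funmx U a id]. *)
Definition funmx U a f : 'M[R]_n := U^T *m diag_mx (map_mx f a) *m U.

(* [trace_fun U a f M] is the trace of [M *m funmx U a f]. *)
Definition trace_fun U a f M : R := \sum_i f (a 0 i) * (U *m M *m U^T) i i.

Lemma funmx_sum U a f :
  funmx U a f = \sum_i f (a 0 i) *: ((row i U)^T *m row i U).
Proof.
apply/matrixP => i j; rewrite /funmx summxE mul_mx_diag !mxE.
apply: eq_bigr => k _; rewrite !mxE big_ord1 !mxE; ring.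
Qed.

Lemma mxtrace_funmx U a f M : \tr (M *m funmx U a f) = trace_fun U a f M.
Proof.
rewrite /funmx !mulmxA mxtrace_mulC !mulmxA mul_mx_diag.
by apply: eq_bigr => i _; rewrite !mxE mulrC.
Qed.

Lemma expr_funmx U a k : U *m U^T = 1%:M ->
  (funmx U a id) ^+ k = funmx U a (fun r => r ^+ k).
Proof.
move=> UU; elim: k => [|k IHk].
  rewrite expr0 /funmx (_ : map_mx _ _ = const_mx 1); last first.
    by apply/rowP => i; rewrite !mxE expr0.
  by rewrite diag_const_mx mulmx1 (mulmx1C UU).
rewrite exprS IHk -[_ * _]/(_ *m _) /funmx.
rewrite !mulmxA -(mulmxA (U^T *m diag_mx _)) UU mulmx1.
rewrite -(mulmxA U^T) mulmx_diag; congr (_ *m diag_mx _ *m _).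
by apply/rowP => i; rewrite !mxE exprS.
Qed.

(** The partial sums split along the rank-one eigenprojections, each with the scalar exponential
    series of one eigenvalue as coefficient. *)
Lemma expmx_funmx U a : U *m U^T = 1%:M ->
  expmx (funmx U a id) = funmx U a expR.
Proof.
move=> UU; rewrite /expmx.
have -> : series (fun k => (k`!%:R)^-1 *: funmx U a id ^+ k) =
    (fun m => \sum_i series (exp_coeff (a 0 i)) m *: ((row i U)^T *m row i U)).
  apply/funext => m; rewrite /series/=.
  under eq_bigr => k _ do rewrite expr_funmx// funmx_sum scaler_sumr.
  rewrite exchange_big; apply: eq_bigr => i _; rewrite scaler_suml.
  by apply: eq_bigr => k _; rewrite scalerA exp_coeffE.
rewrite [RHS]funmx_sum; apply/cvg_lim; first exact: norm_hausdorff.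
apply: cvg_big => [|i _]; first exact: add_continuous.
apply: cvgZr_tmp.
exact: is_cvg_series_exp_coeff.
Qed.

Lemma expmx_oppr_funmx U a : U *m U^T = 1%:M ->
  expmx (- funmx U a id) = funmx U a (fun r => expR (- r)).
Proof.
move=> UU; have -> : - funmx U a id = funmx U (- a) id.
  rewrite !funmx_sum -sumrN; apply: eq_bigr => i _.
  by rewrite mxE scaleNr.
rewrite expmx_funmx// !funmx_sum; apply: eq_bigr => i _.
by rewrite mxE.
Qed.

Lemma symmetric_funmx (A : 'M[R]_n) : A^T = A ->
  exists U a, U *m U^T = 1%:M /\ A = funmx U a id.
Proof.
move=> /symmetric_spectral[U [a [UU AE]]]; exists U, a; split=> //.
by rewrite AE /funmx map_mx_id.
Qed.

Lemma trace_fun1 U a f : U *m U^T = 1%:M ->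
  trace_fun U a f 1%:M = \sum_i f (a 0 i).
Proof.
by move=> UU; apply: eq_bigr => i _; rewrite mulmx1 UU mxE eqxx mulr1.
Qed.

Lemma mxtrace_funmx1 U a f : U *m U^T = 1%:M ->
  \tr (funmx U a f) = \sum_i f (a 0 i).
Proof. by move=> UU; rewrite -[funmx _ _ _]mul1mx mxtrace_funmx trace_fun1. Qed.

Lemma trace_fun_lin U a f (d : nat) (c : 'I_d -> R) (A : 'I_d -> 'M[R]_n) :
  trace_fun U a f (\sum_k c k *: A k) = \sum_k c k * trace_fun U a f (A k).
Proof.
rewrite /trace_fun; under [RHS]eq_bigr do rewrite mulr_sumr.
rewrite exchange_big; apply: eq_bigr => i _.
rewrite mulmx_sumr mulmx_suml summxE mulr_sumr; apply: eq_bigr => k _.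
by rewrite -scalemxAr -scalemxAl mxE mulrCA.
Qed.

Lemma trace_funN U a f M : trace_fun U a (fun r => - f r) M = - trace_fun U a f M.
Proof. by rewrite /trace_fun -sumrN; apply: eq_bigr => i _; rewrite mulNr. Qed.

(** * Comparison of two matrices through entries between their eigenbases *)

Section TwoBases.
Variables (U V : 'M[R]_n) (x y : 'rV[R]_n).
Hypotheses (UU : U *m U^T = 1%:M) (VV : V *m V^T = 1%:M).
Let p := U *m V^T.

Let UtU : U^T *m U = 1%:M. Proof. exact: mulmx1C. Qed.
Let VtV : V^T *m V = 1%:M. Proof. exact: mulmx1C. Qed.

Lemma sandwich_sub i j :
  (U *m (funmx U x id - funmx V y id) *m V^T) i j = (x 0 i - y 0 j) * p i j.
Proof.
rewrite mulmxBr mulmxBl /funmx !mulmxA UU mul1mx.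
rewrite -!mulmxA VV mulmx1 !mulmxA mul_mx_diag -mulmxA mul_diag_mx !mxE.
by rewrite -/p; ring.
Qed.

(** Together with [sum_sandwich_col], this writes traces taken in either eigenbasis as sums over the
    same pairs [(i, j)], so that they can be subtracted termwise. *)
Lemma sum_sandwich_row M i :
  (U *m M *m U^T) i i = \sum_j (U *m M *m V^T) i j * p i j.
Proof.
have -> : U *m M *m U^T = (U *m M *m V^T) *m p^T.
  by rewrite /p trmx_mul trmxK !mulmxA -(mulmxA _ V^T V) VtV mulmx1.
by rewrite [LHS]mxE; apply: eq_bigr => j _; rewrite [p^T _ _]mxE.
Qed.

Lemma sum_sandwich_col M j :
  (V *m M *m V^T) j j = \sum_i (U *m M *m V^T) i j * p i j.
Proof.
have -> : V *m M *m V^T = p^T *m (U *m M *m V^T).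
  by rewrite /p trmx_mul trmxK !mulmxA -(mulmxA V U^T U) UtU mulmx1.
by rewrite [LHS]mxE; apply: eq_bigr => i _; rewrite [p^T _ _]mxE mulrC.
Qed.

Lemma trace_fun_sub f M :
  trace_fun U x f M - trace_fun V y f M =
  \sum_i \sum_j (U *m M *m V^T) i j * p i j * (f (x 0 i) - f (y 0 j)).
Proof.
rewrite /trace_fun; under eq_bigr do rewrite sum_sandwich_row mulr_sumr.
under [X in _ - X]eq_bigr do rewrite sum_sandwich_col mulr_sumr.
rewrite [X in _ - X]exchange_big -sumrB; apply: eq_bigr => i _.
by rewrite -sumrB; apply: eq_bigr => j _; ring.
Qed.

(** For [g] the derivative of [f], the left-hand side is the first-order Taylor remainder of the
    trace. The weights [p i j ^+ 2] are nonnegative, so scalar bounds on the remainder transfer to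
    matrices. *)
Lemma sum_fun_sub f g :
  \sum_i f (x 0 i) - \sum_j f (y 0 j)
    - trace_fun V y g (funmx U x id - funmx V y id) =
  \sum_i \sum_j p i j ^+ 2 *
    (f (x 0 i) - f (y 0 j) - (x 0 i - y 0 j) * g (y 0 j)).
Proof.
rewrite -(trace_fun1 x f UU) -(trace_fun1 y f VV) trace_fun_sub mulmx1 -/p.
rewrite /trace_fun; under [X in _ - X]eq_bigr do rewrite sum_sandwich_col mulr_sumr.
rewrite [X in _ - X]exchange_big -sumrB; apply: eq_bigr => i _.
by rewrite -sumrB; apply: eq_bigr => j _; rewrite sandwich_sub; ring.
Qed.

End TwoBases.
End FunctionalCalculus.

(** * Second-order bounds for perturbations built from psd matrices *)

Section SecondOrder.
Variables (R : realType) (n d : nat) (A : 'I_d -> 'M[R]_n).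
Hypothesis A_psd : forall k, psdmx (A k).
Implicit Types (c : 'I_d -> R) (U V M : 'M[R]_n) (x y a : 'rV[R]_n).

Definition qform M (v : 'rV[R]_n) : R := (v *m M *m v^T) 0 0.
Definition lincomb c : 'M[R]_n := \sum_k c k *: A k.

Lemma psd_sym k : (A k)^T = A k.
Proof.
have [sA _] := A_psd k; have /is_hermitianmxP := sA.
by rewrite expr0 scale1r map_mx_id// => {2}->.
Qed.

Lemma lincomb_sym c : (lincomb c)^T = lincomb c.
Proof.
rewrite /lincomb linear_sum; apply: eq_bigr => k _.
by rewrite linearZ/= psd_sym.
Qed.

Lemma bform_lincomb c (u v : 'rV[R]_n) :
  (u *m lincomb c *m v^T) 0 0 = \sum_k c k * (u *m A k *m v^T) 0 0.
Proof.
rewrite mulmx_sumr mulmx_suml summxE; apply: eq_bigr => k _.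
by rewrite -scalemxAr -scalemxAl mxE.
Qed.

Lemma qform_ge0 c v : (forall k, 0 <= c k) -> 0 <= qform (lincomb c) v.
Proof.
move=> c0; rewrite /qform bform_lincomb sumr_ge0// => k _.
by rewrite mulr_ge0//; have [_] := A_psd k.
Qed.

Lemma qform_le c1 c2 v : (forall k, c1 k <= c2 k) ->
  qform (lincomb c1) v <= qform (lincomb c2) v.
Proof.
move=> c12; rewrite /qform !bform_lincomb ler_sum// => k _.
by rewrite ler_wpM2r//; have [_] := A_psd k.
Qed.

Lemma sandwich_row M U V i j : (U *m M *m (row j V)^T) i 0 = (U *m M *m V^T) i j.
Proof. by rewrite !mxE; apply: eq_bigr => k _; rewrite !mxE. Qed.

Lemma qform_row M U i : (U *m M *m U^T) i i = qform M (row i U).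
Proof.
rewrite /qform !mxE; apply: eq_bigr => j _; rewrite !mxE; congr (_ * _).
by apply: eq_bigr => l _; rewrite !mxE.
Qed.

(* Sum over [k] of the inequality [0 <= qform (A k) (z - c k *: v)]. *)
Lemma lincomb_cauchy c (z v : 'rV[R]_n) :
  2 * (z *m lincomb c *m v^T) 0 0 <=
  qform (lincomb (fun=> 1)) z + qform (lincomb (fun k => c k ^+ 2)) v.
Proof.
rewrite /qform !bform_lincomb mulr_sumr -big_split/= ler_sum// => k _.
have [_ /(_ (z - c k *: v))] := A_psd k.
have -> : (z - c k *: v)^T = z^T - c k *: v^T by rewrite linearB linearZ.
rewrite mulmxBr !mulmxBl -!scalemxAl -!scalemxAr.
rewrite scalerA -expr2.
have -> : v *m A k *m z^T = z *m A k *m v^T.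
  by rewrite row_dotC trmx_mul psd_sym mulmxA.
have lin (b e : R) (X Y Z : 'M[R]_1) :
  (X - b *: Y - (b *: Y - e *: Z)) 0 0 = X 0 0 - b * Y 0 0 - (b * Y 0 0 - e * Z 0 0).
  by rewrite !mxE.
by rewrite lin; lra.
Qed.

(** Duality: [lincomb_cauchy] is applied to the [z] with coordinates [N i 0 / w i] in the basis [U].
    Its bilinear term is then [S] and its quadratic term in [z] is at most [S], so
    [2 S <= S + qform _ v]. *)
Lemma weighted_bessel U (w : 'I_n -> R) : U *m U^T = 1%:M ->
  (forall i, 0 < w i) ->
  (forall z : 'rV[R]_n,
     qform (lincomb (fun=> 1)) z <= \sum_i w i * (z *m U^T) 0 i ^+ 2) ->
  forall c (v : 'rV[R]_n),
  \sum_i (U *m lincomb c *m v^T) i 0 ^+ 2 / w i <=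
  qform (lincomb (fun k => c k ^+ 2)) v.
Proof.
move=> UU w0 wP c v; set N := U *m _ *m _; set S := \sum_i _.
pose r : 'rV[R]_n := \row_i (N i 0 / w i); pose z := r *m U.
have zU : z *m U^T = r by rewrite /z -mulmxA UU mulmx1.
have zz : qform (lincomb (fun=> 1)) z <= S.
  apply: (le_trans (wP z)); rewrite zU le_eqVlt; apply/orP; left; apply/eqP.
  apply: eq_bigr => i _; rewrite mxE; field; exact: lt0r_neq0.
have zv : (z *m lincomb c *m v^T) 0 0 = S.
  have -> : z *m lincomb c *m v^T = r *m N by rewrite /z /N !mulmxA.
  by rewrite mxE; apply: eq_bigr => i _; rewrite mxE; ring.
by have := lincomb_cauchy c z v; rewrite zv; lra.
Qed.

Lemma trace_fun_lincomb_le U a f c1 c2 : (forall i, 0 <= f (a 0 i)) ->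
  (forall k, c1 k <= c2 k) ->
  trace_fun U a f (lincomb c1) <= trace_fun U a f (lincomb c2).
Proof.
move=> f0 c12; rewrite ler_sum// => i _.
by rewrite !qform_row ler_wpM2l// qform_le.
Qed.

Lemma trace_fun_lincombZ U a f c (r : R) :
  trace_fun U a f (lincomb (fun k => r * c k)) = r * trace_fun U a f (lincomb c).
Proof.
by rewrite /lincomb !trace_fun_lin mulr_sumr; apply: eq_bigr => k _; rewrite mulrA.
Qed.

Section Perturbation.
Variables (U V : 'M[R]_n) (x y : 'rV[R]_n).
Hypotheses (UU : U *m U^T = 1%:M) (VV : V *m V^T = 1%:M).
Variables (phi psi h w : R -> R).
Hypotheses (w_x : forall i, 0 < w (x 0 i)) (w_y : forall i, 0 < w (y 0 i)).
Hypotheses (h_x : forall i, 0 <= h (x 0 i)) (h_y : forall i, 0 <= h (y 0 i)).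
Hypothesis wU : forall z : 'rV[R]_n,
  qform (lincomb (fun=> 1)) z <= \sum_i w (x 0 i) * (z *m U^T) 0 i ^+ 2.
Hypothesis wV : forall z : 'rV[R]_n,
  qform (lincomb (fun=> 1)) z <= \sum_i w (y 0 i) * (z *m V^T) 0 i ^+ 2.

(** The kernel that is to dominate the divided differences of [phi]. Its symmetric shape lets each
    summand be handled by the Bessel inequality in one of the two eigenbases. *)
Let kappa r s := h r / w s + h s / w r.
Let H c := trace_fun U x h (lincomb c) + trace_fun V y h (lincomb c).
Let N c i j := (U *m lincomb c *m V^T) i j.

(** For fixed [i] the sum over [j] is a Bessel sum in the basis [V] for the vector [row i U]; for
    fixed [j] the roles are exchanged. Weighting by [h] and summing reassembles the traces in
    [H]. *)
Lemma sum_kernel_le c :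
  \sum_i \sum_j N c i j ^+ 2 * kappa (x 0 i) (y 0 j) <= H (fun k => c k ^+ 2).
Proof.
have -> : \sum_i \sum_j N c i j ^+ 2 * kappa (x 0 i) (y 0 j) =
    \sum_i h (x 0 i) * (\sum_j N c i j ^+ 2 / w (y 0 j)) +
    \sum_j h (y 0 j) * (\sum_i N c i j ^+ 2 / w (x 0 i)).
  under [X in _ = X + _]eq_bigr do rewrite mulr_sumr.
  under [X in _ = _ + X]eq_bigr do rewrite mulr_sumr.
  rewrite [X in _ = _ + X]exchange_big -big_split/=; apply: eq_bigr => i _.
  by rewrite -big_split/=; apply: eq_bigr => j _; rewrite /kappa; ring.
apply: lerD; apply: ler_sum => i _; rewrite ler_wpM2l// qform_row.
  apply: le_trans (weighted_bessel VV w_y wV c (row i U)).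
  rewrite le_eqVlt; apply/orP; left; apply/eqP; apply: eq_bigr => j _.
  congr (_ ^+ 2 / _); rewrite sandwich_row.
  have <- : (U *m lincomb c *m V^T)^T = V *m lincomb c *m U^T.
    by rewrite !trmx_mul trmxK lincomb_sym mulmxA.
  by rewrite [RHS]mxE.
apply: le_trans (weighted_bessel UU w_x wU c (row i V)).
rewrite le_eqVlt; apply/orP; left; apply/eqP; apply: eq_bigr => j _.
by rewrite sandwich_row.
Qed.

Variable c : 'I_d -> R.
Hypothesis diffE : funmx U x id - funmx V y id = lincomb c.

Let p := U *m V^T.
Let NE i j : N c i j = (x 0 i - y 0 j) * p i j.
Proof. by rewrite /N -diffE sandwich_sub. Qed.

Lemma first_order_remainder :
  (forall i j, phi (x 0 i) - phi (y 0 j) - (x 0 i - y 0 j) * psi (y 0 j) <=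
     (x 0 i - y 0 j) ^+ 2 * kappa (x 0 i) (y 0 j)) ->
  \sum_i phi (x 0 i) <= \sum_j phi (y 0 j) + trace_fun V y psi (lincomb c)
    + H (fun k => c k ^+ 2).
Proof.
move=> ker; rewrite -lerBlDl opprD addrA -diffE sum_fun_sub//.
apply: le_trans (sum_kernel_le c); apply: ler_sum => i _; apply: ler_sum => j _.
rewrite NE -/p exprMn [leRHS]mulrAC [leRHS]mulrC.
exact: (ler_wpM2l (sqr_ge0 _) (ker i j)).
Qed.

(** As [|x_i - y_j| * |p i j| = |N c i j|], each term is at most [2 |N b i j| |N c i j|] times the
    kernel; the arithmetic-geometric mean inequality with parameter [t] separates [b] from [c]. *)
Lemma trace_fun_stability (b : 'I_d -> R) (t : R) : 0 < t ->
  (forall i j, `|phi (x 0 i) - phi (y 0 j)| <=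
     2 * `|x 0 i - y 0 j| * kappa (x 0 i) (y 0 j)) ->
  trace_fun U x phi (lincomb b) <= trace_fun V y phi (lincomb b) +
    t * H (fun k => b k ^+ 2) + t^-1 * H (fun k => c k ^+ 2).
Proof.
move=> t0 ker; rewrite -addrA -lerBlDl trace_fun_sub//.
have kap0 i j : 0 <= kappa (x 0 i) (y 0 j).
  by rewrite addr_ge0// divr_ge0// ltW.
apply: (@le_trans _ _ (\sum_i \sum_j
   (t * (N b i j ^+ 2 * kappa (x 0 i) (y 0 j)) +
    t^-1 * (N c i j ^+ 2 * kappa (x 0 i) (y 0 j))))); last first.
  under eq_bigr do rewrite big_split/= -!mulr_sumr.
  rewrite big_split/= -!mulr_sumr lerD// ler_wpM2l ?sum_kernel_le//.
    exact: ltW.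
  by rewrite invr_ge0 ltW.
apply: ler_sum => i _; apply: ler_sum => j _; rewrite NE -/p.
rewrite -/(N b i j); set k := kappa _ _; set z := x 0 i - y 0 j.
rewrite (le_trans (ler_norm _))// !normrM.
apply: (@le_trans _ _ (`|N b i j| * `|p i j| * (2 * `|z| * k))).
  by rewrite ler_wpM2l ?mulr_ge0//; exact: ker.
have -> : t * (N b i j ^+ 2 * k) + t^-1 * ((z * p i j) ^+ 2 * k) =
   k * (t * `|N b i j| ^+ 2 + t^-1 * (`|z| * `|p i j|) ^+ 2).
  by rewrite -normrM !real_normK ?num_real//; ring.
have -> : `|N b i j| * `|p i j| * (2 * `|z| * k) =
   k * (2 * (`|N b i j| * (`|z| * `|p i j|))) by ring.
rewrite ler_wpM2l ?kap0//; set u := `|N b i j|; set v := `|z| * _.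
have -> : t * u ^+ 2 + t^-1 * v ^+ 2 = t * (u - t^-1 * v) ^+ 2 + 2 * (u * v).
  by field; exact: lt0r_neq0.
by rewrite lerDr mulr_ge0 ?sqr_ge0 ?ltW.
Qed.

End Perturbation.
End SecondOrder.

(** * Scalar divided-difference bounds for the exponential *)

Section ExponentialKernels.
Variable R : realType.
Implicit Types a b r s t K : R.

Lemma expR_tangent a b : expR a - expR b <= (a - b) * expR a.
Proof.
have := expR_ge1Dx (b - a); rewrite expRD expRN => H.
have a0 := expR_gt0 a.
have : (1 + (b - a)) * expR a <= expR b.
  by rewrite -ler_pdivlMr.
lra.
Qed.

Lemma expR_lipschitz a b : `|expR a - expR b| <= `|a - b| * (expR a + expR b).
Proof.
wlog ab : a b / b <= a.
  move=> W; have [/W//|/ltW/W] := leP b a.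
  by move=> H; rewrite distrC (distrC a b) (addrC (expR a)).
rewrite !ger0_norm ?subr_ge0 ?ler_expR// mulrDr.
by rewrite (le_trans (expR_tangent a b))// lerDl mulr_ge0 ?expR_ge0 ?subr_ge0.
Qed.

Lemma expR_second_order a b :
  expR a - expR b - (a - b) * expR b <= (a - b) ^+ 2 * (expR a + expR b).
Proof.
have H : expR a - expR b - (a - b) * expR b <= (a - b) * (expR a - expR b).
  by have := expR_tangent a b; lra.
apply: (le_trans H); apply: (le_trans (ler_norm _)); rewrite normrM.
rewrite -real_normK ?num_real// expr2 -mulrA ler_wpM2l//.
exact: expR_lipschitz.
Qed.

(* Weight [cut_weight K] replaces the identity by a function that is bounded
   below, and [cut_exp K] is the majorant of [expR (- r)] for which the divided
   differences of [expR (- _)] are dominated by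
   [cut_exp K r / cut_weight K s + cut_exp K s / cut_weight K r]. *)
Definition cut_weight K r : R := Num.max r (2 * K).
Definition cut_exp K r : R := expR (- r) * Num.max (2 * K) (r + 1).

Lemma cut_weight_gt0 K r : 0 < K -> 0 < cut_weight K r.
Proof. by move=> K0; rewrite lt_max mulr_gt0 ?orbT. Qed.

Lemma cut_exp_ge0 K r : 0 < K -> 0 <= cut_exp K r.
Proof.
by move=> K0; rewrite mulr_ge0 ?expR_ge0// le_max mulr_ge0// ltW.
Qed.

(** After division by [expR (- s)] the claim is [max(r, 2K) <= max(1, r - s) * max(2K, s + 1)]. The
    summand 1 in [s + 1] makes it hold for long gaps: [r = s + (r - s) <= (r - s) * (s + 1)] once
    [r - s >= 1]. *)
Lemma expRN_le_cut K r s : 1 <= K -> 0 <= s -> s <= r ->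
  expR (- s) <= Num.max 1 (r - s) * (cut_exp K s / cut_weight K r).
Proof.
move=> K1 s0 sr; have K0 : 0 < K by lra.
rewrite mulrA ler_pdivlMr ?cut_weight_gt0// /cut_exp mulrCA.
rewrite ler_wpM2l ?expR_ge0//.
have m1 : 1 <= Num.max 1 (r - s) by rewrite le_max lexx.
have mt : r - s <= Num.max 1 (r - s) by rewrite le_max lexx orbT.
have n1 : 2 * K <= Num.max (2 * K) (s + 1) by rewrite le_max lexx.
have ns : s + 1 <= Num.max (2 * K) (s + 1) by rewrite le_max lexx orbT.
set m := Num.max 1 _ in m1 mt *; set q := Num.max _ (s + 1) in n1 ns *.
rewrite ge_max; apply/andP; split; nra.
Qed.

Lemma cut_kernel_lipschitz K r s : 1 <= K -> 0 <= r -> 0 <= s ->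
  `|expR (- r) - expR (- s)| <= 2 * `|r - s| *
    (cut_exp K r / cut_weight K s + cut_exp K s / cut_weight K r).
Proof.
move=> K1; have K0 : 0 < K by lra.
wlog sr : r s / s <= r.
  move=> W r0 s0; have [sr|/ltW sr] := leP s r; first exact: W.
  by rewrite distrC (distrC r s) [X in _ * X]addrC; exact: W.
move=> r0 s0; have q2 : 0 <= cut_exp K r / cut_weight K s.
  by rewrite divr_ge0 ?cut_exp_ge0 ?ltW ?cut_weight_gt0.
have q1 : 0 <= cut_exp K s / cut_weight K r.
  by rewrite divr_ge0 ?cut_exp_ge0 ?ltW ?cut_weight_gt0.
have := expRN_le_cut K1 s0 sr; move: q1 q2.
set q := cut_exp K s / _; set q' := cut_exp K r / _ => q1 q2 ub.
rewrite distrC !ger0_norm ?subr_ge0 ?ler_expR ?lerN2//.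
have tan := expR_tangent (- s) (- r).
have e1 := expR_ge0 (- r); have e2 := expR_ge0 (- s).
(* For a gap of at most 1 the tangent bound supplies the factor [r - s]; for a longer gap
   [expR (- s)] alone bounds the difference and [expRN_le_cut] supplies that factor. *)
have [t1|t1] := leP (r - s) 1.
  by rewrite (max_idPl t1) in ub; nra.
by rewrite (max_idPr (ltW t1)) in ub; nra.
Qed.

Lemma cut_kernel_second_order K r s : 1 <= K -> 0 <= r -> 0 <= s ->
  expR (- r) - expR (- s) - (r - s) * (- expR (- s)) <= (r - s) ^+ 2 *
    (cut_exp K r / cut_weight K s + cut_exp K s / cut_weight K r).
Proof.
move=> K1 r0 s0; have K0 : 0 < K by lra.
have q2 : 0 <= cut_exp K r / cut_weight K s.
  by rewrite divr_ge0 ?cut_exp_ge0 ?ltW ?cut_weight_gt0.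
have q1 : 0 <= cut_exp K s / cut_weight K r.
  by rewrite divr_ge0 ?cut_exp_ge0 ?ltW ?cut_weight_gt0.
have tan := expR_tangent (- s) (- r); have tan' := expR_tangent (- r) (- s).
have e1 := expR_ge0 (- r); have e2 := expR_ge0 (- s).
have [sr|/ltW rs] := leP s r.
  have ub := expRN_le_cut K1 s0 sr; move: q1 q2 ub.
  set q := cut_exp K s / _; set q' := cut_exp K r / _ => q1 q2 ub.
  have er : expR (- r) <= expR (- s) by rewrite ler_expR lerN2.
  have [t1|t1] := leP (r - s) 1.
    rewrite (max_idPl t1) in ub.
    apply: (@le_trans _ _ ((r - s) ^+ 2 * expR (- s))); last first.
      by rewrite ler_wpM2l ?sqr_ge0//; lra.
    rewrite expr2; nra.
  rewrite (max_idPr (ltW t1)) in ub.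
  apply: (@le_trans _ _ ((r - s) * expR (- s))); first lra.
  rewrite expr2 -mulrA ler_wpM2l//; nra.
have ub := expRN_le_cut K1 r0 rs; move: q1 q2 ub.
set q := cut_exp K s / _; set q' := cut_exp K r / _ => q1 q2 ub.
have es : expR (- s) <= expR (- r) by rewrite ler_expR lerN2.
have [t1|t1] := leP (s - r) 1.
  rewrite (max_idPl t1) in ub.
  apply: (@le_trans _ _ ((r - s) ^+ 2 * expR (- r))); last first.
    by rewrite ler_wpM2l ?sqr_ge0//; lra.
  rewrite expr2; nra.
rewrite (max_idPr (ltW t1)) in ub.
apply: (@le_trans _ _ ((s - r) * expR (- r))); first nra.
have -> : (r - s) ^+ 2 = (s - r) * (s - r) by ring.
by rewrite -mulrA ler_wpM2l//; nra.
Qed.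

(** [s ^+ 2 * expR (- s)] decreases beyond 2, and the right-hand side is its value at
    [T = 3K/2 >= 3]. The proof squares [s / T <= expR ((s - T) / T)]. *)
Lemma sqr_expRN_le K s : 2 <= K -> 3 / 2 * K <= s ->
  s ^+ 2 * expR (- s) <= 9 / 4 * K ^+ 2 * expR (- (3 / 2 * K)).
Proof.
move=> K2 Ks; set T := 3 / 2 * K; have T0 : 2 < T by rewrite /T; lra.
have Tn0 : T != 0 by rewrite gt_eqF//; lra.
have -> : 9 / 4 * K ^+ 2 = T ^+ 2 by rewrite /T; field.
have sT : s <= T * expR ((s - T) / T).
  rewrite [leLHS](_ : _ = T * (1 + (s - T) / T)); last by field.
  by rewrite ler_wpM2l ?expR_ge1Dx// ltW// (lt_trans _ T0).
have s2 : s ^+ 2 <= T ^+ 2 * expR (s - T).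
  have s0 : 0 <= s by rewrite /T in T0; lra.
  apply: (@le_trans _ _ ((T * expR ((s - T) / T)) ^+ 2)).
    by rewrite ler_sqr ?nnegrE// (le_trans s0).
  rewrite exprMn ler_wpM2l ?sqr_ge0// expr2 -expRD ler_expR.
  have : (s - T) / T <= (s - T) / 2.
    by rewrite ler_wpM2l ?subr_ge0// lef_pV2 ?posrE//; lra.
  lra.
apply: (@le_trans _ _ (T ^+ 2 * expR (s - T) * expR (- s))).
  by rewrite ler_wpM2r ?expR_ge0.
rewrite -mulrA -expRD ler_wpM2l ?sqr_ge0// ler_expR; lra.
Qed.

(** Below [3K/2] the maximum in [cut_exp] is [2K], because [K >= 2]. Beyond it the maximum is at
    most [2 s], so the product is at most [s ^+ 2 * expR (- s) / 2], which [sqr_expRN_le] absorbs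
    into the error. *)
Lemma cut_exp_le K q s : 2 <= K -> 0 <= q -> q <= s / 4 ->
  cut_exp K s * q <= 2 * K * (expR (- s) * q) +
    9 / 8 * K ^+ 2 * expR (- (3 / 2 * K)).
Proof.
move=> K2 q0 qs; have e0 := expR_ge0 (- s).
have E0 : 0 <= 9 / 8 * K ^+ 2 * expR (- (3 / 2 * K)).
  by rewrite mulr_ge0 ?expR_ge0// mulr_ge0 ?sqr_ge0//; lra.
have [Ks|sK] := leP (3 / 2 * K) s; last first.
  rewrite /cut_exp (max_idPl _); last lra.
  by rewrite -[leLHS]addr0 lerD// -mulrA mulrCA mulrA.
have m : Num.max (2 * K) (s + 1) <= 2 * s by rewrite ge_max; apply/andP; split; lra.
have := sqr_expRN_le K2 Ks => B.
apply: (@le_trans _ _ (s ^+ 2 * expR (- s) / 2)); last first.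
  apply: (@le_trans _ _ (9 / 8 * K ^+ 2 * expR (- (3 / 2 * K)))); first lra.
  by rewrite lerDr !mulr_ge0//; lra.
rewrite /cut_exp.
apply: (@le_trans _ _ (expR (- s) * (2 * s) * (s / 4))); last lra.
apply: ler_pM => //.
  by rewrite mulr_ge0// le_max; apply/orP; left; lra.
by rewrite ler_wpM2l.
Qed.

End ExponentialKernels.

(** * Effect of one multiplicative update on a trace function *)

Section MultiplicativeStep.
Variables (R : realType) (n d : nat) (A : 'I_d -> 'M[R]_n).
Hypothesis A_psd : forall k, psdmx (A k).
Variables (U V : 'M[R]_n) (x y : 'rV[R]_n).
Hypotheses (UU : U *m U^T = 1%:M) (VV : V *m V^T = 1%:M).
Variables (al : R) (dl : 'I_d -> R).
Hypotheses (al_gt0 : 0 < al) (dl_itv : forall k, 0 <= dl k <= 1 / 2).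
Hypothesis yE : funmx V y id = lincomb A (fun=> 1).
Hypothesis xE : funmx U x id = lincomb A (fun k => 1 + al * dl k).

Let dl2 k := dl k ^+ 2.

Let diffE : funmx U x id - funmx V y id = lincomb A (fun k => al * dl k).
Proof.
rewrite xE yE /lincomb -sumrB; apply: eq_bigr => k _.
by rewrite -scalerBl addrC addKr.
Qed.

Lemma qform_funmx (W : 'M[R]_n) (a z : 'rV[R]_n) f :
  qform (funmx W a f) z = \sum_i f (a 0 i) * (z *m W^T) 0 i ^+ 2.
Proof.
rewrite /qform /funmx !mulmxA mul_mx_diag -mulmxA.
have -> : W *m z^T = (z *m W^T)^T by rewrite trmx_mul trmxK.
by rewrite mxE; apply: eq_bigr => i _; rewrite !mxE; ring.
Qed.

Lemma qform_le_funmx_old z :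
  qform (lincomb A (fun=> 1)) z <= \sum_i y 0 i * (z *m V^T) 0 i ^+ 2.
Proof. by rewrite -yE qform_funmx. Qed.

(** The multipliers [1 + al * dl k] are at least 1, so the old sum is also dominated in the new
    eigenbasis, as the Bessel inequality there requires. *)
Lemma qform_le_funmx_new z :
  qform (lincomb A (fun=> 1)) z <= \sum_i x 0 i * (z *m U^T) 0 i ^+ 2.
Proof.
have <- := qform_funmx U x z id; rewrite xE; apply: qform_le => // k.
by rewrite lerDl mulr_ge0 ?(ltW al_gt0)//; have /andP[] := dl_itv k.
Qed.

Section Abstract.
Variables (phi psi h w : R -> R) (M e : R).
Hypotheses (w_x : forall i, 0 < w (x 0 i)) (w_y : forall i, 0 < w (y 0 i)).
Hypotheses (h_x : forall i, 0 <= h (x 0 i)) (h_y : forall i, 0 <= h (y 0 i)).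
Hypothesis wU : forall z : 'rV[R]_n,
  qform (lincomb A (fun=> 1)) z <= \sum_i w (x 0 i) * (z *m U^T) 0 i ^+ 2.
Hypothesis wV : forall z : 'rV[R]_n,
  qform (lincomb A (fun=> 1)) z <= \sum_i w (y 0 i) * (z *m V^T) 0 i ^+ 2.
Hypothesis ker_second_order : forall i j,
  phi (x 0 i) - phi (y 0 j) - (x 0 i - y 0 j) * psi (y 0 j) <=
  (x 0 i - y 0 j) ^+ 2 *
    (h (x 0 i) / w (y 0 j) + h (y 0 j) / w (x 0 i)).
Hypothesis ker_lipschitz : forall i j,
  `|phi (x 0 i) - phi (y 0 j)| <= 2 * `|x 0 i - y 0 j| *
    (h (x 0 i) / w (y 0 j) + h (y 0 j) / w (x 0 i)).
Let T W a f := trace_fun W a f (lincomb A dl2).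
Hypothesis h_le : T U x h + T V y h <= M * (T U x phi + T V y phi) + e.
Hypothesis (M_ge0 : 0 <= M) (alM : al * M < 1).

(** The remainder is [al ^+ 2 * H], where [H] also involves the new eigenbasis. Stability returns to
    the old one at the cost of [al * H], giving [(1 - al * M) * H <= 2 * M * T V y phi + e]. *)
Lemma multiplicative_step :
  \sum_i phi (x 0 i) <= \sum_j phi (y 0 j) +
    trace_fun V y psi (lincomb A (fun k => al * dl k)) +
    al * (2 * (al * M) * T V y phi + al * e) / (1 - al * M).
Proof.
have Zc : trace_fun U x h (lincomb A (fun k => (al * dl k) ^+ 2)) +
    trace_fun V y h (lincomb A (fun k => (al * dl k) ^+ 2)) =
    al ^+ 2 * (T U x h + T V y h).
  have -> : lincomb A (fun k => (al * dl k) ^+ 2) =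
      lincomb A (fun k => al ^+ 2 * dl2 k).
    by apply: eq_bigr => k _; rewrite exprMn.
  by rewrite !trace_fun_lincombZ mulrDr.
have S1 := first_order_remainder A_psd UU VV w_x w_y h_x h_y wU wV diffE
  ker_second_order.
(* With [dl ^+ 4 <= dl ^+ 2 / 4], the parameter [t = 2 * al] makes both error terms of the stability
   bound equal to [al / 2 * H]. *)
have t0 : 0 < 2 * al by rewrite mulr_gt0.
have S2 := trace_fun_stability A_psd UU VV w_x w_y h_x h_y wU wV diffE dl2
  t0 ker_lipschitz.
have D4 : trace_fun U x h (lincomb A (fun k => dl2 k ^+ 2)) +
    trace_fun V y h (lincomb A (fun k => dl2 k ^+ 2)) <=
    4^-1 * (T U x h + T V y h).
  rewrite mulrDr -!trace_fun_lincombZ lerD// trace_fun_lincomb_le// => k;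
  have /andP[d0 d1] := dl_itv k; rewrite /dl2; have : dl k ^+ 2 <= 1 / 4 by nra.
    by move: (sqr_ge0 (dl k)); nra.
  by move: (sqr_ge0 (dl k)); nra.
rewrite Zc in S1 S2; have hle := h_le; set H := T U x h + T V y h in Zc S1 S2 D4 hle.
have S3 : T U x phi <= T V y phi + al * H.
  apply: (le_trans S2); rewrite -addrA lerD2l.
  have -> : (2 * al)^-1 * (al ^+ 2 * H) = al / 2 * H.
    by field; exact: lt0r_neq0.
  have := ler_wpM2l (ltW t0) D4.
  by rewrite -/(T _ _ _); lra.
have S4 : (1 - al * M) * H <= 2 * M * T V y phi + e.
  by have := ler_wpM2l M_ge0 S3; lra.
apply: (le_trans S1); rewrite lerD2l.
rewrite ler_pdivlMr ?subr_gt0//.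
have := ler_wpM2l (ltW (mulr_gt0 al_gt0 al_gt0)) S4; lra.
Qed.

End Abstract.

Lemma multiplicative_step_bounded (phi psi : R -> R) (th : R) :
  0 < th -> al * th < 1 ->
  (forall z : 'rV[R]_n, qform (lincomb A (fun=> 1)) z <= th * (z *m z^T) 0 0) ->
  (forall r, 0 <= phi r) ->
  (forall r s, phi r - phi s - (r - s) * psi s <= (r - s) ^+ 2 * (phi r + phi s)) ->
  (forall r s, `|phi r - phi s| <= `|r - s| * (phi r + phi s)) ->
  \sum_i phi (x 0 i) <= \sum_j phi (y 0 j) +
    trace_fun V y psi (lincomb A (fun k => al * dl k)) +
    al * (2 * (al * th) / (1 - al * th)) * trace_fun V y phi (lincomb A dl2).
Proof.
move=> th0 alth Ath phi0 ker2 ker1.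
have sqz (W : 'M[R]_n) (z : 'rV[R]_n) : W *m W^T = 1%:M ->
    th * (z *m z^T) 0 0 = \sum_i th * (z *m W^T) 0 i ^+ 2.
  move=> /mulmx1C WW; rewrite -mulr_sumr; congr (_ * _).
  transitivity (((z *m W^T) *m (z *m W^T)^T) 0 0).
    by rewrite trmx_mul trmxK mulmxA -(mulmxA z) WW mulmx1.
  by rewrite mxE; apply: eq_bigr => i _; rewrite [X in _ * X]mxE.
have thE r s : th * phi r / th + th * phi s / th = phi r + phi s.
  by field; exact: lt0r_neq0.
(* A constant weight [th] with [h = th * phi] reduces the kernel to [phi r + phi s], with [M = th]
   and no additive error. *)
have := @multiplicative_step phi psi (fun r => th * phi r) (fun=> th) th 0.
rewrite (_ : al * (_ + _) / _ =
  al * (2 * (al * th) / (1 - al * th)) * trace_fun V y phi (lincomb A dl2)); last by ring.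
apply=> //.
- by move=> i; rewrite mulr_ge0// ltW.
- by move=> i; rewrite mulr_ge0// ltW.
- by move=> z; rewrite -sqz.
- by move=> z; rewrite -sqz.
- by move=> i j; rewrite thE.
- move=> i j; rewrite thE (le_trans (ker1 _ _))// -mulrA ler_peMl ?ler1n//.
  by rewrite mulr_ge0 ?addr_ge0.
- rewrite addr0 mulrDr /trace_fun !mulr_sumr lerD//; apply: ler_sum => i _;
  by rewrite mulrA.
- exact: ltW.
Qed.

Lemma multiplicative_step_cut (K : R) : 2 <= K -> al = (8 * K)^-1 ->
  \sum_i expR (- x 0 i) <= \sum_j expR (- y 0 j) +
    trace_fun V y (fun r => - expR (- r)) (lincomb A (fun k => al * dl k)) +
    al * (2 / 3) * trace_fun V y (fun r => expR (- r)) (lincomb A dl2) +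
    3 / 64 * n%:R * expR (- (3 / 2 * K)).
Proof.
move=> K2 alE; have K0 : 0 < K by lra.
have K1 : 1 <= K by lra.
have dl4 k : dl2 k <= 1 / 4.
  by have /andP[] := dl_itv k; rewrite /dl2; nra.
have dl2_ge0 k : 0 <= dl2 k by exact: sqr_ge0.
have diagE (W : 'M[R]_n) (a : 'rV[R]_n) i : W *m W^T = 1%:M ->
    (W *m funmx W a id *m W^T) i i = a 0 i.
  move=> WW; rewrite /funmx !mulmxA WW mul1mx -mulmxA WW mulmx1.
  by rewrite !mxE eqxx.
(* Diagonal entries of the [dl2]-combination are at most a quarter of the eigenvalues, since
   [dl2 k <= 1/4]; this is the condition [q <= s / 4] of [cut_exp_le]. *)
have qq (W : 'M[R]_n) (a : 'rV[R]_n) (c : 'I_d -> R) i : W *m W^T = 1%:M ->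
    funmx W a id = lincomb A c -> (forall k, 1 <= c k) ->
    0 <= (W *m lincomb A dl2 *m W^T) i i <= a 0 i / 4.
  move=> WW aE c1; rewrite qform_row qform_ge0//= -(diagE W) // aE qform_row.
  rewrite ler_pdivlMr// mulrC.
  have -> (v : 'rV[R]_n) : 4 * qform (lincomb A dl2) v =
      qform (lincomb A (fun k => 4 * dl2 k)) v.
    by rewrite /qform !bform_lincomb mulr_sumr; apply: eq_bigr => k _; rewrite mulrA.
  by apply: qform_le => // k; have := dl4 k; have := c1 k; lra.
have qx i := qq U x _ i UU xE.
have {}qx i : 0 <= (U *m lincomb A dl2 *m U^T) i i <= x 0 i / 4.
  by apply: qx => k; rewrite lerDl mulr_ge0 ?(ltW al_gt0)//; have /andP[] := dl_itv k.
have qy i : 0 <= (V *m lincomb A dl2 *m V^T) i i <= y 0 i / 4 by exact: (qq V y _ i VV yE).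
have x0 i : 0 <= x 0 i by have /andP[] := qx i; lra.
have y0 i : 0 <= y 0 i by have /andP[] := qy i; lra.
have al8 : al * (2 * K) = 1 / 4 by rewrite alE; field; exact: lt0r_neq0.
(* With [M = 2K], [al * M = 1/4] yields the factor [2 (1/4) / (3/4) = 2/3]. The error collects
   [9/8 n K^2 E] from each eigenbasis, and [al^2 * (9/4) n K^2 E / (3/4) = 3/64 n E]. *)
have := @multiplicative_step (fun r => expR (- r)) (fun r => - expR (- r))
  (cut_exp K) (cut_weight K) (2 * K)
  (9 / 4 * n%:R * K ^+ 2 * expR (- (3 / 2 * K))).
set E := expR (- (3 / 2 * K)); set Ty := trace_fun V y (fun r => expR (- r)) (lincomb A dl2).
rewrite (_ : al * (_ + _) / _ = al * (2 / 3) * Ty + 3 / 64 * n%:R * E); last first.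
  rewrite al8 alE; field; exact: lt0r_neq0.
rewrite addrA; apply.
- by move=> i; exact: cut_weight_gt0.
- by move=> i; exact: cut_weight_gt0.
- by move=> i; exact: cut_exp_ge0.
- by move=> i; exact: cut_exp_ge0.
- move=> z; apply: (le_trans (qform_le_funmx_new z)); apply: ler_sum => i _.
  by rewrite ler_wpM2r ?sqr_ge0// le_max lexx.
- move=> z; apply: (le_trans (qform_le_funmx_old z)); apply: ler_sum => i _.
  by rewrite ler_wpM2r ?sqr_ge0// le_max lexx.
- by move=> i j; exact: cut_kernel_second_order.
- by move=> i j; exact: cut_kernel_lipschitz.
- have tailE (W : 'M[R]_n) (a : 'rV[R]_n) :
      (forall i, 0 <= (W *m lincomb A dl2 *m W^T) i i <= a 0 i / 4) ->
      trace_fun W a (cut_exp K) (lincomb A dl2) <=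
      2 * K * trace_fun W a (fun r => expR (- r)) (lincomb A dl2) +
      9 / 8 * n%:R * K ^+ 2 * E.
    move=> qa; rewrite /trace_fun mulr_sumr.
    have -> : 9 / 8 * n%:R * K ^+ 2 * E = \sum_(i < n) (9 / 8 * K ^+ 2 * E).
      by rewrite sumr_const card_ord -mulr_natr; ring.
    rewrite -big_split/=; apply: ler_sum => i _.
    by have /andP[q0 q1] := qa i; exact: cut_exp_le.
  have := lerD (tailE U x qx) (tailE V y qy); rewrite -/Ty => /le_trans; apply.
  by rewrite le_eqVlt; apply/orP; left; apply/eqP; field.
- by rewrite mulr_ge0// ltW.
- by rewrite al8; lra.
Qed.

End MultiplicativeStep.

(** * Extreme eigenvalues and quadratic forms *)

Section Eigenvalues.
Variables (R : realType) (n : nat).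
Implicit Types (U M : 'M[R]_n) (a z : 'rV[R]_n).

Lemma row_orthogonal_neq0 U i : U *m U^T = 1%:M -> row i U != 0.
Proof.
move=> UU; apply: contra_eq_neq UU => U0.
apply/eqP => /matrixP/(_ i i); rewrite !mxE eqxx/= big1 => [/eqP|j _].
  by rewrite eq_sym oner_eq0.
by move/rowP/(_ j) : U0; rewrite !mxE => ->; rewrite mul0r.
Qed.

Lemma eigenvalue_funmx U a r : U *m U^T = 1%:M ->
  eigenvalue (funmx U a id) r <-> exists i, r = a 0 i.
Proof.
move=> UU; split.
  move=> /eigenvalueP[v vA v0]; pose w := v *m U^T.
  have w0 : w != 0.
    apply: contra v0 => /eqP w0.
    by rewrite -[v]mulmx1 -(mulmx1C UU) mulmxA -/w w0 mul0mx.
  have wE : w *m diag_mx a = r *: w.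
    rewrite /w scalemxAl -vA /funmx map_mx_id// !mulmxA -[RHS]mulmxA UU mulmx1.
    by [].
  have [i wi] : exists i, w 0 i != 0.
    by apply/rV0Pn.
  exists i; move/rowP/(_ i) : wE; rewrite mul_mx_diag [LHS]mxE [RHS]mxE => /eqP.
  by rewrite mulrC -subr_eq0 -mulrBl mulf_eq0 (negbTE wi) orbF subr_eq0
    eq_sym => /eqP.
move=> [i ->]; apply/eigenvalueP; exists (row i U); last exact: row_orthogonal_neq0.
rewrite /funmx map_mx_id// !mulmxA -row_mul UU -row_mul mul1mx.
by apply/rowP => j; rewrite [LHS]mxE (bigD1 i)//= big1 ?addr0 => [|k ki];
  rewrite !mxE ?eqxx ?mulr1n// eq_sym (negbTE ki) mulr0n mul0r.
Qed.

Lemma lambda_max_ge U a i : U *m U^T = 1%:M ->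
  a 0 i <= lambda_max (funmx U a id).
Proof.
move=> UU; apply: ub_le_sup; last by apply/(eigenvalue_funmx _ _ UU); exists i.
exists (\sum_j `|a 0 j|) => r /(eigenvalue_funmx _ _ UU)[j ->].
by rewrite (le_trans (ler_norm _))// (bigD1 j)//= lerDl sumr_ge0.
Qed.

Lemma lambda_max_le U a (r : R) : (0 < n)%N -> U *m U^T = 1%:M ->
  (forall i, a 0 i <= r) -> lambda_max (funmx U a id) <= r.
Proof.
move=> n0 UU ar; apply: ge_sup.
  by exists (a 0 (Ordinal n0)); apply/(eigenvalue_funmx _ _ UU); eexists.
by move=> s /(eigenvalue_funmx _ _ UU)[j ->].
Qed.

Lemma lambda_min_attained U a : (0 < n)%N -> U *m U^T = 1%:M ->
  exists i, a 0 i <= lambda_min (funmx U a id).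
Proof.
move=> n0 UU; pose i := [arg min_(j < Ordinal n0) a 0 j]%O.
exists i; apply: lb_le_inf.
  by exists (a 0 (Ordinal n0)); apply/(eigenvalue_funmx _ _ UU); eexists.
move=> s /(eigenvalue_funmx _ _ UU)[j ->]; rewrite /i.
by case: arg_minP => // k _; apply.
Qed.

Lemma qform_le_lambda_max M z : M^T = M ->
  qform M z <= lambda_max M * (z *m z^T) 0 0.
Proof.
move=> /symmetric_funmx[U [a [UU ->]]]; rewrite qform_funmx.
have -> : (z *m z^T) 0 0 = \sum_i (z *m U^T) 0 i ^+ 2.
  transitivity (((z *m U^T) *m (z *m U^T)^T) 0 0).
    by rewrite trmx_mul trmxK mulmxA -(mulmxA z) (mulmx1C UU) mulmx1.
  by rewrite mxE; apply: eq_bigr => i _; rewrite [X in _ * X]mxE.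
rewrite mulr_sumr ler_sum// => i _.
by rewrite ler_wpM2r ?sqr_ge0// lambda_max_ge.
Qed.

Lemma qform_funmx_row U a i : U *m U^T = 1%:M ->
  qform (funmx U a id) (row i U) = a 0 i.
Proof.
move=> UU; rewrite -qform_row /funmx !mulmxA UU mul1mx -mulmxA UU mulmx1.
by rewrite !mxE eqxx.
Qed.

Lemma psdmx_sym M : psdmx M -> M^T = M.
Proof. by move=> M0; have := @psd_sym _ _ 1 (fun=> M) (fun=> M0) ord0. Qed.

Lemma psdmxZ (c : R) M : 0 <= c -> psdmx M -> psdmx (c *: M).
Proof.
move=> c0 M0; have [sM pM] := M0; split.
  apply/is_hermitianmxP; rewrite expr0 scale1r map_mx_id// linearZ/=.
  by rewrite psdmx_sym.
by move=> v; rewrite -scalemxAr -scalemxAl mxE mulr_ge0.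
Qed.

Lemma lambda_max_ge0 M : (0 < n)%N -> psdmx M -> 0 <= lambda_max M.
Proof.
move=> n0 M0; have [U [a [UU ME]]] := symmetric_funmx (psdmx_sym M0).
rewrite ME; apply: le_trans (lambda_max_ge a (Ordinal n0) UU).
by rewrite -(qform_funmx_row a _ UU) -ME; have [_ H] := M0; exact: H.
Qed.

Lemma lambda_max_gt0 M : (0 < n)%N -> psdmx M -> M <> 0 -> 0 < lambda_max M.
Proof.
move=> n0 M0 Mn0; rewrite lt_def lambda_max_ge0// andbT; apply/eqP => l0.
have [U [a [UU ME]]] := symmetric_funmx (psdmx_sym M0).
apply: Mn0; rewrite ME funmx_sum big1// => i _.
suff -> : a 0 i = 0 by rewrite scale0r.
apply/eqP; rewrite eq_le -{1}l0 ME lambda_max_ge//=.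
by rewrite -(qform_funmx_row a _ UU) -ME; have [_ H] := M0; exact: H.
Qed.

Lemma lambda_max_scale_le M (c r : R) : (0 < n)%N -> psdmx M -> 0 <= c -> 0 <= r ->
  (forall z, c * qform M z <= r * (z *m z^T) 0 0) -> c * lambda_max M <= r.
Proof.
move=> n0 M0 c0 r0 cM; have [U [a [UU ME]]] := symmetric_funmx (psdmx_sym M0).
have [->|cn0] := eqVneq c 0; first by rewrite mul0r.
have {}c0 : 0 < c by rewrite lt_def cn0.
rewrite mulrC -ler_pdivlMr// ME lambda_max_le// => i.
rewrite ler_pdivlMr// mulrC -(qform_funmx_row a i UU) -ME (le_trans (cM _))//.
have -> : row i U *m (row i U)^T = 1%:M.
  apply/matrixP => j k; rewrite !ord1.
  have := qform_row 1%:M U i; rewrite mulmx1 UU /qform mulmx1 => <-.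
  by rewrite !mxE !eqxx.
by rewrite mxE eqxx mulr1.
Qed.

Lemma trace_funZ U a f c M : trace_fun U a f (c *: M) = c * trace_fun U a f M.
Proof.
rewrite /trace_fun mulr_sumr; apply: eq_bigr => i _.
by rewrite -scalemxAr -scalemxAl mxE mulrCA.
Qed.

Lemma trace_fun_ge0 U a f M : psdmx M -> (forall r, 0 <= f r) ->
  0 <= trace_fun U a f M.
Proof.
by move=> [_ M0] f0; rewrite sumr_ge0// => i _; rewrite qform_row mulr_ge0// M0.
Qed.

End Eigenvalues.

(** * Invariants of the iterates and spectral bounds under the guard *)

Section AlgorithmFacts.
Variables (R : realType) (n d : nat) (P C : 'I_d -> 'M[R]_n) (eps : R).
Hypothesis n_gt0 : (0 < n)%N.
Hypotheses (P_psd : forall i, psdmx (P i)) (C_psd : forall i, psdmx (C i)).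
Implicit Types x : 'rV[R]_d.

Let K := bigK P C eps.
Let al := alpha P C eps.

Lemma scaled_psd (A : 'I_d -> 'M[R]_n) x : (forall i, psdmx (A i)) ->
  (forall i, 0 <= x 0 i) -> forall i, psdmx (x 0 i *: A i).
Proof. by move=> A0 x0 i; exact: psdmxZ. Qed.

(* [packing] and [covering] are convertible, so the lemmas below are applied to
   [C] as well. *)
Lemma packing_lincomb (A : 'I_d -> 'M[R]_n) x :
  packing A x = lincomb (fun i => x 0 i *: A i) (fun=> 1).
Proof. by apply: eq_bigr => i _; rewrite scale1r. Qed.

Lemma packing_update (A : 'I_d -> 'M[R]_n) x :
  packing A (update P C eps x) = lincomb (fun i => x 0 i *: A i)
    (fun i => 1 + al * delta P C eps x i).
Proof. by apply: eq_bigr => i _; rewrite mxE scalerA mulrC. Qed.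

Lemma qform_packing (A : 'I_d -> 'M[R]_n) x z :
  qform (packing A x) z = \sum_i x 0 i * qform (A i) z.
Proof.
rewrite packing_lincomb /qform bform_lincomb; apply: eq_bigr => i _.
by rewrite mul1r -scalemxAr -scalemxAl mxE.
Qed.

Lemma packing_psd (A : 'I_d -> 'M[R]_n) x : (forall i, psdmx (A i)) ->
  (forall i, 0 <= x 0 i) -> psdmx (packing A x).
Proof.
move=> A0 x0; split.
  apply/is_hermitianmxP; rewrite expr0 scale1r map_mx_id// packing_lincomb.
  by rewrite lincomb_sym// => i; exact: psdmxZ.
move=> v; rewrite -/(qform _ _) qform_packing sumr_ge0// => i _.
by rewrite mulr_ge0//; have [_ H] := A0 i; exact: H.
Qed.

Lemma packing_diag (A : 'I_d -> 'M[R]_n) x : (forall i, psdmx (A i)) ->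
  (forall i, 0 <= x 0 i) ->
  exists V y, V *m V^T = 1%:M /\ packing A x = funmx V y id.
Proof.
by move=> A0 x0; apply: symmetric_funmx; apply: psdmx_sym; exact: packing_psd.
Qed.

(** The sign of [K] comes from the guard: [K] bounds the largest eigenvalue of a psd matrix. *)
Lemma guard_bigK_ge0 x : (forall i, 0 <= x 0 i) -> guard P C eps x -> 0 <= K.
Proof.
move=> x0 /andP[+ _]; apply: le_trans.
exact: (lambda_max_ge0 n_gt0 (packing_psd P_psd x0)).
Qed.

Lemma sum_expR_gt0 (f : R -> R) (y : 'rV[R]_n) :
  0 < \sum_i expR (f (y 0 i)).
Proof.
rewrite (bigD1 (Ordinal n_gt0))//= ltr_wpDr ?expR_gt0//.
by rewrite sumr_ge0// => i _; exact: expR_ge0.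
Qed.

Lemma gradP_funmx x V y i : V *m V^T = 1%:M -> packing P x = funmx V y id ->
  gradP P x i = trace_fun V y expR (P i) / \sum_i expR (y 0 i).
Proof.
move=> VV E; rewrite /gradP /mxdot /Ymx E expmx_funmx// -scalemxAr linearZ/=.
by rewrite mxtrace_funmx mxtrace_funmx1// mulrC.
Qed.

Lemma gradC_funmx x V y i : V *m V^T = 1%:M -> packing C x = funmx V y id ->
  gradC C x i =
  trace_fun V y (fun r => expR (- r)) (C i) / \sum_i expR (- y 0 i).
Proof.
move=> VV E; rewrite /gradC /mxdot /Zmx -[covering C x]/(packing C x) E.
rewrite expmx_oppr_funmx// -scalemxAr linearZ/=.
by rewrite mxtrace_funmx mxtrace_funmx1// mulrC.
Qed.

Lemma gradP_ge0 x i : (forall i, 0 <= x 0 i) -> 0 <= gradP P x i.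
Proof.
move=> x0; have [V [y [VV E]]] := packing_diag P_psd x0.
rewrite (gradP_funmx i VV E) divr_ge0 ?trace_fun_ge0//.
exact: ltW (sum_expR_gt0 id y).
Qed.

Lemma gradC_ge0 x i : (forall i, 0 <= x 0 i) -> 0 <= gradC C x i.
Proof.
move=> x0; have [V [y [VV E]]] := packing_diag C_psd x0.
rewrite (gradC_funmx i VV E) divr_ge0 ?trace_fun_ge0//.
exact: ltW (sum_expR_gt0 -%R y).
Qed.

Hypothesis eps_gt0 : 0 < eps.

Lemma delta_bounds x i : (forall i, 0 <= x 0 i) ->
  0 <= delta P C eps x i <= 1 / 2 /\
  (delta P C eps x i != 0 ->
   gradP P x i <= (1 - 2 * delta P C eps x i) * gradC C x i).
Proof.
move=> x0.
have half (q : R) : 0 <= q -> q <= 1 - eps / 2 -> 0 <= (1 - q) / 2 <= 1 / 2.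
  by move: eps_gt0 => e0 q0 q1; apply/andP; split; lra.
rewrite /delta inE; move: (gradP_ge0 i x0) (gradC_ge0 i x0).
move: (gradP P x i) (gradC C x i) => p c p0 c0; case: ifPn => [W|_]; last first.
  by rewrite eqxx; split => //; apply/andP; split; lra.
(* When [gradC] vanishes, division by zero gives 0 and hence [delta = 1/2]; membership in [Wset]
   then says [gradP <= 0], which is the claim. *)
have [c_eq0|cn0] := eqVneq c 0.
  rewrite c_eq0 mulr0 in W *; rewrite invr0 mulr0 subr0.
  by split; [apply/andP; split; lra|move=> _; lra].
have {}c0 : 0 < c by rewrite lt_def cn0.
split.
  by apply: half; rewrite ?ler_pdivrMr ?divr_ge0// ltW.
by move=> _; rewrite le_eqVlt; apply/orP; left; apply/eqP; field.
Qed.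

Lemma alpha_ge0 : 0 <= K -> 0 <= al.
Proof. by move=> K0; rewrite invr_ge0 mulr_ge0. Qed.

Lemma alg_succ t x' : alg P C eps t.+1 = Running x' ->
  exists x, [/\ alg P C eps t = Running x, guard P C eps x &
    x' = update P C eps x].
Proof.
rewrite /alg iterS; case: (iter _ _ _) => [x|x|] //=.
case: ifP => // gx; case: ifP => // _ [<-].
by exists x.
Qed.

Hypothesis P_neq0 : forall i, P i <> 0.

Lemma alg_ge0 t x : alg P C eps t = Running x -> forall i, 0 <= x 0 i.
Proof.
elim: t x => [|t IHt] x.
  move=> [<-] i; rewrite mxE invr_ge0 mulr_ge0 ?lambda_max_ge0//.
move=> /alg_succ[z [/IHt z0 gz ->]] i; rewrite mxE.
have [/andP[d0 _] _] := delta_bounds i z0.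
by rewrite mulr_ge0// addr_ge0// mulr_ge0// alpha_ge0// (guard_bigK_ge0 z0 gz).
Qed.

Lemma width_ge0 : 0 <= width P C.
Proof. exact: bigmax_ge_id. Qed.

Lemma lambda_max_width i : lambda_max (C i) <= width P C * lambda_max (P i).
Proof.
by rewrite -ler_pdivrMr ?lambda_max_gt0//; exact: le_bigmax.
Qed.

Lemma ndrho_ge0 : 0 <= ndrho P C.
Proof. by rewrite mulr_ge0 ?width_ge0// mulr_ge0. Qed.

Lemma qform_packing_guard x z : (forall i, 0 <= x 0 i) -> guard P C eps x ->
  qform (packing P x) z <= K * (z *m z^T) 0 0.
Proof.
move=> x0 /andP[gP _].
apply: (le_trans (qform_le_lambda_max z (psdmx_sym (packing_psd P_psd x0)))).
by rewrite ler_wpM2r ?row_sqnorm_ge0.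
Qed.

(** Each [x_i P_i] lies below the packing sum, so [x_i * lambda_max (P i) <= K]; the width turns
    this into the bound [width * K] for each of the [d] terms [x_i C_i]. *)
Lemma qform_covering_width x z : (forall i, 0 <= x 0 i) -> guard P C eps x ->
  qform (packing C x) z <= d%:R * width P C * K * (z *m z^T) 0 0.
Proof.
move=> x0 gx; rewrite qform_packing.
have -> : d%:R * width P C * K * (z *m z^T) 0 0 =
    \sum_(i < d) (width P C * K * (z *m z^T) 0 0).
  by rewrite sumr_const card_ord -mulr_natr; ring.
apply: ler_sum => i _.
have xK : x 0 i * lambda_max (P i) <= K.
  apply: lambda_max_scale_le => //; first exact: guard_bigK_ge0 gx.
  move=> v; apply: le_trans (qform_packing_guard v x0 gx).
  rewrite qform_packing (bigD1 i)//= lerDl sumr_ge0// => j _.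
  by rewrite mulr_ge0//; have [_ H] := P_psd j; exact: H.
have zz := row_sqnorm_ge0 z.
apply: (@le_trans _ _ (x 0 i * (lambda_max (C i) * (z *m z^T) 0 0))).
  by rewrite ler_wpM2l// qform_le_lambda_max// psdmx_sym.
rewrite mulrA ler_wpM2r//.
apply: (@le_trans _ _ (x 0 i * (width P C * lambda_max (P i)))).
  by rewrite ler_wpM2l// lambda_max_width.
by rewrite mulrCA ler_wpM2l// width_ge0.
Qed.

End AlgorithmFacts.

(** * Scalar inequalities for combining the two trace bounds *)

Lemma ln_sub_le (R : realType) (a b r : R) :
  0 < a -> 0 < b -> a <= b * (1 + r) -> ln a - ln b <= r.
Proof.
move=> a0 b0 ab; have ab1 : a / b <= 1 + r by rewrite ler_pdivrMr// mulrC.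
have ab0 : 0 < a / b by exact: divr_gt0.
rewrite -ln_div ?posrE//; apply: (@le_trans _ _ (ln (1 + r))).
  by rewrite ler_ln ?posrE// (lt_le_trans ab0).
by apply: le_ln1Dx; lra.
Qed.

(** For [e = delta] the gain is [(e + 2/7 e^2) (1 - 2 e) = e - 12/7 e^2 - 4/7 e^3], which is below
    [e - 2/3 e^2]. *)
Lemma step_coeff_le (R : realType) (e r p c : R) :
  0 <= e -> e <= 1 / 2 -> 0 <= r -> 0 <= c -> 0 <= p ->
  (e != 0 -> p <= (1 - 2 * e) * c) ->
  (e + 2 / 7 * e ^+ 2) * (r * p) <= (e - 2 / 3 * e ^+ 2) * (r * c).
Proof.
move=> e0 e1 r0 c0 p0; have [-> _|en0 /(_ isT) pc] := eqVneq e 0.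
  by rewrite expr2 !mulr0 addr0 subr0 !mul0r.
rewrite mulrCA [leRHS]mulrCA ler_wpM2l//.
apply: (@le_trans _ _ ((e + 2 / 7 * e ^+ 2) * ((1 - 2 * e) * c))).
  by rewrite ler_wpM2l// addr_ge0// mulr_ge0 ?sqr_ge0.
rewrite mulrA ler_wpM2r//.
have e3 : 0 <= e ^+ 3 by rewrite exprn_ge0.
by have := sqr_ge0 e; lra.
Qed.

(** * Change of the potential in one iteration *)

Section PotentialStep.
Variables (R : realType) (n d : nat) (P C : 'I_d -> 'M[R]_n) (eps : R).
Hypothesis n_gt0 : (0 < n)%N.
Hypotheses (P_psd : forall i, psdmx (P i)) (C_psd : forall i, psdmx (C i)).
Hypotheses (P_neq0 : forall i, P i <> 0).
Hypotheses (eps_gt0 : 0 < eps) (eps_le : eps <= 1 / 20).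
Variable x : 'rV[R]_d.
Hypotheses (x_ge0 : forall i, 0 <= x 0 i) (gx : guard P C eps x).

Let K := bigK P C eps.
Let al := alpha P C eps.
Let dl := delta P C eps x.
Let x' := update P C eps x.
Hypothesis K_gt0 : 0 < K.

Let al_gt0 : 0 < al. Proof. by rewrite invr_gt0 mulr_gt0. Qed.

Let alK : al * K = 1 / 8.
Proof. by rewrite /al /alpha -/K; field; exact: lt0r_neq0. Qed.

Let dl_itv i : 0 <= dl i <= 1 / 2.
Proof. by have [] := delta_bounds n_gt0 P_psd C_psd eps_gt0 i x_ge0. Qed.

Lemma update_ge0 i : 0 <= x' 0 i.
Proof.
by rewrite mxE mulr_ge0// addr_ge0// mulr_ge0 ?(ltW al_gt0)//; have /andP[] := dl_itv i.
Qed.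

(** For [S] the trace of the exponential, the quotients on the right are the normalised
    gradients. *)
Lemma trace_fun_scaled V (y : 'rV[R]_n) f (A : 'I_d -> 'M[R]_n) c (S : R) : S != 0 ->
  trace_fun V y f (lincomb (fun i => x 0 i *: A i) c) =
  S * \sum_i c i * (x 0 i * (trace_fun V y f (A i) / S)).
Proof.
move=> S0; rewrite /lincomb trace_fun_lin mulr_sumr; apply: eq_bigr => i _.
by rewrite trace_funZ; field.
Qed.

Lemma packing_step : \tr (Ymx P x') <= \tr (Ymx P x) *
  (1 + al * \sum_i (dl i + 2 / 7 * dl i ^+ 2) * (x 0 i * gradP P x i)).
Proof.
have [V [y [VV yE]]] := packing_diag P_psd x_ge0.
have [U [u [UU uE]]] := packing_diag P_psd update_ge0.
have S0 := lt0r_neq0 (sum_expR_gt0 n_gt0 id y).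
rewrite /Ymx uE yE !expmx_funmx// !mxtrace_funmx1//.
under [X in al * X]eq_bigr do rewrite (gradP_funmx _ VV yE).
have A_psd := scaled_psd P_psd x_ge0.
have := @multiplicative_step_bounded _ _ _ _ A_psd U V u y UU VV al dl al_gt0
  dl_itv (etrans (esym yE) (packing_lincomb P x))
  (etrans (esym uE) (packing_update P C eps P x)) expR expR K K_gt0.
rewrite alK => /(_ _ (fun z => _) _ _ _) H.
apply: le_trans (H _ _ _ _ _) _.
- by lra.
- by move=> z; rewrite -packing_lincomb qform_packing_guard.
- by move=> r; exact: expR_ge0.
- by move=> r s; exact: expR_second_order.
- by move=> r s; exact: expR_lipschitz.
rewrite !(trace_fun_scaled _ _ _ _ _ S0); set S := \sum_i expR (y 0 i).
set g := fun i => x 0 i * (trace_fun V y expR (P i) / S).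
have -> : \sum_k al * dl k * g k = al * \sum_k dl k * g k.
  by rewrite mulr_sumr; apply: eq_bigr => i _; rewrite mulrA.
have -> : \sum_i (dl i + 2 / 7 * dl i ^+ 2) * g i =
    \sum_i dl i * g i + 2 / 7 * \sum_i dl i ^+ 2 * g i.
  by rewrite mulr_sumr -big_split/=; apply: eq_bigr => i _; ring.
rewrite le_eqVlt; apply/orP; left; apply/eqP.
(* Here [al * K = 1/8], so the coefficient is [2 (1/8) / (7/8) = 2/7]. *)
by rewrite (_ : 1 - 1 / 8 = 7 / 8); [field|lra].
Qed.

Lemma expRN_bigK_le_trZ : expR (- K) <= \tr (Zmx C x).
Proof.
have [V [y [VV yE]]] := packing_diag C_psd x_ge0.
have [i yi] := lambda_min_attained y n_gt0 VV.
rewrite /Zmx -[covering C x]/(packing C x) yE expmx_oppr_funmx// mxtrace_funmx1//.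
rewrite (bigD1 i)//= ler_wpDr ?sumr_ge0//.
rewrite ler_expR lerN2 (le_trans yi)// -yE.
by case/andP: gx.
Qed.

(** Put [r = ndrho] and [L = ln r]. Then [r >= 2 n] absorbs the factor [n], and [eps <= 1/20] gives
    [K >= 80 L], so that [L - 3/2 K <= - K - 15 L]. *)
Lemma cut_error : 2 < d%:R * width P C ->
  2 <= K /\ 3 / 64 * n%:R * expR (- (3 / 2 * K)) <= expR (- K) * ndrho P C ^- 15.
Proof.
move=> dw; set r := ndrho P C.
have n1 : 1 <= n%:R :> R by rewrite ler1n.
have rn : 2 * n%:R <= r.
  by rewrite /r /ndrho -mulrA mulrC ler_wpM2l// ltW.
have r2 : 2 <= r by lra.
have r0 : 0 < r by lra.
pose L := ln r.
have L2 : 1 / 2 <= L.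
  (* [ln 2 >= 1/2] follows from [ln (1/2) <= - 1/2]. *)
  have := le_ln1Dx (_ : -1 < - (1 / 2)) => /(_ R); rewrite ltrN2 => H.
  have {}H : ln (1 + - (1 / 2)) <= - (1 / 2) :> R by apply: le_ln1Dx; lra.
  have -> : L = - ln r^-1 by rewrite lnV ?posrE// opprK.
  rewrite lerNr (le_trans _ H)// ler_ln ?posrE ?invr_gt0//; last lra.
  by rewrite (_ : 1 + - (1 / 2) = 2^-1) ?lef_pV2 ?posrE//; field.
have KL : 80 * L <= K.
  rewrite /K /bigK -/r -/L ler_pdivlMr//.
  by have := ler_wpM2l (_ : 0 <= L) eps_le; lra.
split; first lra.
have rE : r = expR L by rewrite lnK ?posrE.
have -> : r ^- 15 = expR (- (15 * L)).
  by rewrite rE -expRM_natl -expRN.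
rewrite -expRD; apply: (@le_trans _ _ (r * expR (- (3 / 2 * K)))).
  by rewrite ler_wpM2r ?expR_ge0//; lra.
by rewrite rE -expRD ler_expR; lra.
Qed.

Lemma covering_step : \tr (Zmx C x') <= \tr (Zmx C x) *
  (1 - al * \sum_i (dl i - 2 / 3 * dl i ^+ 2) * (x 0 i * gradC C x i)
     + ndrho P C ^- 15).
Proof.
have trK := expRN_bigK_le_trZ; move: trK.
have [V [y [VV yE]]] := packing_diag C_psd x_ge0.
have [U [u [UU uE]]] := packing_diag C_psd update_ge0.
have S0 := lt0r_neq0 (sum_expR_gt0 n_gt0 -%R y).
rewrite /Zmx -[covering C x]/(packing C x) -[covering C x']/(packing C x').
rewrite uE yE !expmx_oppr_funmx// !mxtrace_funmx1// => trK.
under [X in al * X]eq_bigr do rewrite (gradC_funmx _ VV yE).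
have A_psd := scaled_psd C_psd x_ge0.
set S := \sum_i expR (- y 0 i).
set g := fun i => x 0 i * (trace_fun V y (fun r => expR (- r)) (C i) / S).
have r0 : 0 <= ndrho P C ^- 15 by rewrite invr_ge0 exprn_ge0// ndrho_ge0.
suff H : \sum_i expR (- u 0 i) <= S - al * (S * \sum_i dl i * g i) +
    al * (2 / 3) * (S * \sum_i dl i ^+ 2 * g i) + expR (- K) * ndrho P C ^- 15.
  apply: (le_trans H).
  have -> : \sum_i (dl i - 2 / 3 * dl i ^+ 2) * g i =
      \sum_i dl i * g i - 2 / 3 * \sum_i dl i ^+ 2 * g i.
    by rewrite mulr_sumr -sumrB/=; apply: eq_bigr => i _; ring.
  have := ler_wpM2r r0 trK; rewrite -/S.
  by move: (ndrho P C ^- 15) (expR (- K)) => q e; lra.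
have lin1 : trace_fun V y (fun r => - expR (- r))
    (lincomb (fun i => x 0 i *: C i) (fun k => al * dl k)) =
    - (al * (S * \sum_i dl i * g i)).
  rewrite trace_funN (trace_fun_scaled _ _ _ _ _ S0) mulrCA; congr (- (_ * _)).
  by rewrite mulr_sumr; apply: eq_bigr => i _; rewrite -/S -/(g i); ring.
have yl := etrans (esym yE) (packing_lincomb C x).
have ul := etrans (esym uE) (packing_update P C eps C x).
(* A large [d * width] makes the truncation error negligible; otherwise the covering sum is at most
   [2K] and the bounded step applies with the same coefficient 2/3. *)
have [dw|dw] := leP (d%:R * width P C) 2; last first.
  have [K2 err] := cut_error dw.
  have := multiplicative_step_cut A_psd UU VV al_gt0 dl_itv yl ul K2 erefl.
  rewrite lin1 (trace_fun_scaled _ _ _ _ _ S0) -/S -/g => H.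
  by apply: (le_trans H); rewrite lerD2l.
have := @multiplicative_step_bounded _ _ _ _ A_psd U V u y UU VV al dl al_gt0
  dl_itv yl ul (fun r => expR (- r)) (fun r => - expR (- r)) (2 * K).
rewrite lin1 (trace_fun_scaled _ _ _ _ _ S0) -/S -/g.
have al2K : al * (2 * K) = 1 / 4 by rewrite mulrCA alK; lra.
have e4 : 2 * (1 / 4) / (1 - 1 / 4) = 2 / 3 :> R.
  by rewrite (_ : 1 - 1 / 4 = 3 / 4 :> R); [field|lra].
rewrite al2K e4.
move=> H; rewrite -[leLHS]addr0 lerD//; last by rewrite mulr_ge0 ?expR_ge0.
apply: H.
- by rewrite mulr_gt0.
- by lra.
- move=> z; rewrite -packing_lincomb.
  apply: (le_trans (qform_covering_width n_gt0 P_psd C_psd P_neq0 z x_ge0 gx)).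
  by rewrite ler_wpM2r ?row_sqnorm_ge0// ler_wpM2r// ltW.
- by move=> r; exact: expR_ge0.
- by move=> r s; have := expR_second_order (- r) (- s); lra.
- move=> r s; have := expR_lipschitz (- r) (- s).
  by rewrite -opprD normrN.
Qed.

Lemma potential_step :
  potential P C eps x' <= potential P C eps x + ndrho P C ^- 15.
Proof.
(* Here [u] bounds the increase of the packing logarithm and [v] is the covering gain; [0 <= u <= v]
   makes [(1 - eps) * u - v] nonpositive. *)
have combine (p p' q q' u v r : R) : p' - p <= u -> q' - q <= - v + r ->
    0 <= u -> u <= v -> (1 - eps) * p' + q' <= (1 - eps) * p + q + r.
  move=> pu qv u0 uv; have e1 : 0 <= 1 - eps by move: eps_le; lra.
  by have := ler_wpM2l e1 pu; have := mulr_ge0 (ltW eps_gt0) u0; lra.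
have trP (z : 'rV[R]_d) : (forall i, 0 <= z 0 i) -> 0 < \tr (Ymx P z).
  move=> z0; have [V [y [VV yE]]] := packing_diag P_psd z0.
  by rewrite /Ymx yE expmx_funmx// mxtrace_funmx1// (sum_expR_gt0 n_gt0 id).
have trZ (z : 'rV[R]_d) : (forall i, 0 <= z 0 i) -> 0 < \tr (Zmx C z).
  move=> z0; have [V [y [VV yE]]] := packing_diag C_psd z0.
  rewrite /Zmx -[covering C z]/(packing C z) yE expmx_oppr_funmx//.
  by rewrite mxtrace_funmx1// (sum_expR_gt0 n_gt0 -%R).
have HP := ln_sub_le (trP _ update_ge0) (trP _ x_ge0) packing_step.
have := covering_step; rewrite -addrA => cov.
have HZ := ln_sub_le (trZ _ update_ge0) (trZ _ x_ge0) cov.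
rewrite /potential -/(Ymx P _) -/(Zmx C _) -/(Ymx P x) -/(Zmx C x).
move: HP HZ; set a := \sum_i _; set b := \sum_i _ => HP HZ.
have a0 : 0 <= al * a.
  rewrite mulr_ge0 ?(ltW al_gt0)// sumr_ge0// => i _.
  have /andP[d0 _] := dl_itv i.
  by rewrite !mulr_ge0 ?addr_ge0 ?mulr_ge0 ?sqr_ge0 ?gradP_ge0.
suff ab : a <= b.
  exact: combine HP HZ a0 (ler_wpM2l (ltW al_gt0) ab).
apply: ler_sum => i _.
have /andP[d0 d1] := dl_itv i.
have [_] := delta_bounds n_gt0 P_psd C_psd eps_gt0 i x_ge0; rewrite -/dl -/(dl i).
have := gradP_ge0 n_gt0 P_psd i x_ge0; have := gradC_ge0 n_gt0 C_psd i x_ge0.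
have := x_ge0 i.
by move=> r0 c0 p0 pc; exact: step_coeff_le.
Qed.

End PotentialStep.

Theorem theorem4p3 (R : realType) (n d : nat) (P C : 'I_d -> 'M[R]_n) (eps : R)
  (n_gt0 : (0 < n)%N) (d_gt0 : (0 < d)%N)
  (P_psd : forall i, psdmx (P i)) (C_psd : forall i, psdmx (C i))
  (P_neq0 : forall i, P i <> 0)
  (eps_ge : (n%:R * d%:R) ^- 3 <= eps) (eps_le : eps <= 1 / 20)
  (t : nat) (x x' : 'rV[R]_d)
  (xt : alg P C eps t = Running x) (xt1 : alg P C eps t.+1 = Running x') :
  potential P C eps x' <= potential P C eps x + ndrho P C ^- 15.
Proof.
have eps_gt0 : 0 < eps.
  by apply: lt_le_trans eps_ge; rewrite invr_gt0 exprn_gt0// mulr_gt0 ?ltr0n.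
have x_ge0 := alg_ge0 n_gt0 P_psd C_psd eps_gt0 xt.
have [z [zt gz ->]] := alg_succ xt1.
move: zt gz; rewrite xt => -[<-] gx.
have := guard_bigK_ge0 n_gt0 P_psd x_ge0 gx.
rewrite le_eqVlt => /orP[/eqP K0|]; last exact: potential_step.
(* If [K = 0], the convention that 0 has inverse 0 gives [alpha = 0], and the update leaves [x]
   fixed. *)
have -> : update P C eps x = x.
  by apply/rowP => i; rewrite mxE /alpha -K0 mulr0 invr0 mul0r addr0 mulr1.
by rewrite lerDl invr_ge0 exprn_ge0// ndrho_ge0.
Qed.
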